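(* Let $n\ge5$, let $Q$ be the affine quiver of type $\widetilde{\mathbb D}_n$ with the orientation given in the context, and let $X(Q)\subset\mathbb C^n$ be its frieze variety. For each irreducible component $Y$ of $X(Q)$ there are numbers $a_i,b_i\in\mathbb C^*$ for $i\in\{1,2,n-1,n\}$ and $c_k,d_k,e_k\in\mathbb C$ for $3\le k\le n-2$, with $\alpha:=a_1b_n-a_nb_1\neq0$, such that $Y$ is the Zariski closure of the set of points $(r_1(t),\dots,r_n(t))$, $t\in\mathbb C^*$, where $r_i(t)=\frac{a_it^2+b_i}{t}$ for $i\in\{1,2,n-1,n\}$ and $r_k(t)=\frac{c_kt^4+d_kt^2+e_k}{t^2}$ for $3\le k\le n-2$, and such that $\{L_2,\dots,L_{n-1},H\}$ is a Gröbner basis of the vanishing ideal $\mathrm I(Y)\subset\mathbb C[x_1,\dots,x_n]$ with respect to the lexicographic order $x_2>\dots>x_{n-1}>x_n>x_1$, where $L_2=x_2-x_1$, $L_{n-1}=x_{n-1}-x_n$, $$L_k=x_k+\frac{a_1a_ne_k-b_1b_nc_k}{a_1b_1\alpha}x_1^2-\frac{a_1^2e_k-b_1^2c_k}{a_1b_1\alpha}x_1x_n+\frac{a_1^2e_k-a_1b_1d_k+b_1^2c_k}{a_1b_1}\quad(3\le k\le n-2),$$ $$H=a_nb_nx_1^2-(a_1b_n+a_nb_1)x_1x_n+a_1b_1x_n^2+\alpha^2 .$$ In particular, every irreducible component of $X(Q)$ is isomorphic to a plane conic and is smooth.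
   Context: The quiver of type $\widetilde{\mathbb D}_n$ (here $n$ is the number of vertices, $n\ge5$) has vertices $1,\dots,n$ and arrows $3\to1$, $3\to2$, $n-2\to n-3\to\dots\to3$, $n\to n-2$, $n-1\to n-2$. Frieze variety: define positive rational numbers by $a_{i,0}=1$ and $a_{i,t+1}a_{i,t}=\prod_{j\to i}a_{j,t}\cdot\prod_{i\to k}a_{k,t+1}+1$ for $t\ge0$ and $1\le i\le n$ (products over arrows of $Q$; equivalently $(a_{1,t},\dots,a_{n,t})=\mu_c^t(\mathbf x)|_{\mathbf x=(1,\dots,1)}$ where $\mu_c=\mu_n\cdots\mu_1$ is the Coxeter mutation). Then $X(Q)$ is the Zariski closure in $\mathbb C^n$ of $\{(a_{1,t},\dots,a_{n,t}):t\ge0\}$. A plane conic means a curve in $\mathbb C^2$ defined by a polynomial of degree $2$. *)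

(* Defs.v *)
From HB Require Import structures.
From mathcomp Require Import all_boot all_order all_algebra.
From mathcomp Require Import boolp classical_sets reals.
From mathcomp Require Import complex.
From mathcomp.multinomials Require Import mpoly.
From mathcomp Require Import zify.

Set Implicit Arguments.
Unset Strict Implicit.
Unset Printing Implicit Defensive.

Import Order.TTheory GRing.Theory Num.Theory.
Local Open Scope ring_scope.
Local Open Scope classical_set_scope.

(** * Affine algebraic sets; the points of K^n are the functions 'I_n -> K *)

Section AffineGeometry.
Variable K : fieldType.

Definition zero_locus n (S : set {mpoly K[n]}) : set ('I_n -> K) :=
  [set x | forall p, S p -> p.@[x] = 0].

Definition vanishing_ideal n (A : set ('I_n -> K)) : set {mpoly K[n]} :=
  [set p | forall x, A x -> p.@[x] = 0].

Definition zariski_closed n (Z : set ('I_n -> K)) : Prop :=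
  exists S, Z = zero_locus S.

Definition zariski_closure n (A : set ('I_n -> K)) : set ('I_n -> K) :=
  smallest (@zariski_closed n) A.

Definition irreducible n (Z : set ('I_n -> K)) : Prop :=
  [/\ zariski_closed Z, Z !=set0 &
    forall Z1 Z2, zariski_closed Z1 -> zariski_closed Z2 ->
      Z = Z1 `|` Z2 -> Z = Z1 \/ Z = Z2].

Definition irreducible_component n (X Y : set ('I_n -> K)) : Prop :=
  [/\ irreducible Y, Y `<=` X &
    forall Z, irreducible Z -> Z `<=` X -> Y `<=` Z -> Z = Y].

Definition poly_map m n (f : 'I_n -> {mpoly K[m]}) (x : 'I_m -> K) : 'I_n -> K :=
  fun i => (f i).@[x].

Definition isomorphic m n (Y : set ('I_m -> K)) (Z : set ('I_n -> K)) : Prop :=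
  exists (f : 'I_n -> {mpoly K[m]}) (g : 'I_m -> {mpoly K[n]}),
    [/\ forall y, Y y -> Z (poly_map f y),
        forall z, Z z -> Y (poly_map g z),
        forall y, Y y -> poly_map g (poly_map f y) = y &
        forall z, Z z -> poly_map f (poly_map g z) = z].

(* [msize q] is one more than the total degree of [q]. *)
Definition plane_conic (Z : set ('I_2 -> K)) : Prop :=
  exists q : {mpoly K[2]}, msize q = 3 /\ Z = zero_locus [set q].

Definition irreducible_chain n (Z : set ('I_n -> K)) (d : nat) : Prop :=
  exists W : nat -> set ('I_n -> K),
    (forall i, (i <= d)%N -> irreducible (W i) /\ W i `<=` Z) /\
    (forall i, (i < d)%N -> W i `<` W i.+1).

(* Krull dimension *)
Definition has_dimension n (Z : set ('I_n -> K)) (d : nat) : Prop :=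
  irreducible_chain Z d /\ forall d', irreducible_chain Z d' -> (d' <= d)%N.

Definition tangent_space n (Z : set ('I_n -> K)) (x : 'I_n -> K) :
    set 'rV[K]_n :=
  [set v | forall f, vanishing_ideal Z f ->
     \sum_(i < n) (mderiv i f).@[x] * v ord0 i = 0].

(* For irreducible [Z], all of whose points have local dimension [dim Z]. *)
Definition smooth n (Z : set ('I_n -> K)) : Prop :=
  exists d, has_dimension Z d /\
    forall x, Z x -> exists U : {vspace 'rV[K]_n},
      \dim U = d /\ forall v, v \in U <-> tangent_space Z x v.

(** * Groebner bases *)

(* Lexicographic order for which the variables decrease along [s]; it is a
   monomial order when [s] enumerates 'I_n. *)
Definition lex_le n (s : seq 'I_n) : rel 'X_{1..n} :=
  fun m1 m2 =>
    (([seq m1 i | i <- s] : seqlexi nat) <= [seq m2 i | i <- s])%O.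

Definition leading_terms n (ord : rel 'X_{1..n}) (A : set {mpoly K[n]}) :
    set {mpoly K[n]} :=
  [set q | exists p m, [/\ A p, m \in msupp p,
     forall m', m' \in msupp p -> ord m' m & q = p@_m *: 'X_[m]]].

Definition generated_ideal n (S : set {mpoly K[n]}) : set {mpoly K[n]} :=
  [set p | exists r : seq ({mpoly K[n]} * {mpoly K[n]}),
     (forall u, u \in r -> S u.2) /\ p = \sum_(u <- r) u.1 * u.2].

Definition groebner_basis n (ord : rel 'X_{1..n}) (I : set {mpoly K[n]})
    (G : seq {mpoly K[n]}) : Prop :=
  (forall g, g \in G -> I g) /\
  generated_ideal (leading_terms ord [set` G]) =
  generated_ideal (leading_terms ord I).

End AffineGeometry.

(** * The frieze of a quiver without multiple arrows; [Q i j] means i -> j *)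

Section Frieze.
Variables (n : nat) (Q : rel 'I_n).

(* Exchange relation at a vertex [i] whose neighbours all lie on the same side
   (a sink or a source), so that the other product of the relation is 1.  Along
   mu_n ... mu_1 this is the case as soon as all arrows of [Q] go from larger
   to smaller vertices. *)
Definition mutate (a : {ffun 'I_n -> rat}) (i : 'I_n) : {ffun 'I_n -> rat} :=
  [ffun k => if k == i
             then (\prod_(j | Q j i) a j * \prod_(j | Q i j) a j + 1) / a i
             else a k].

Definition coxeter_mutation (a : {ffun 'I_n -> rat}) : {ffun 'I_n -> rat} :=
  foldl mutate a (enum 'I_n).

Definition frieze (t : nat) : {ffun 'I_n -> rat} :=
  iter t coxeter_mutation [ffun=> 1].

Definition frieze_variety (K : fieldType) : set ('I_n -> K) :=
  zariski_closure (range (fun t : nat => fun i => ratr (frieze t i) : K)).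

Definition mutate_upto a m := foldl mutate a (take m (enum 'I_n)).

Lemma mutate_uptoS a (i : 'I_n) :
  mutate_upto a i.+1 = mutate (mutate_upto a i) i.
Proof.
rewrite /mutate_upto (take_nth i) ?size_enum_ord // foldl_rcons.
by congr mutate; apply: val_inj; rewrite /= nth_enum_ord.
Qed.

Lemma mutate_upto_ge a m (k : 'I_n) : (m <= k)%N -> mutate_upto a m k = a k.
Proof.
elim: m => [|m IH] mk; first by rewrite /mutate_upto take0.
have ltm : (m < n)%N := ltn_trans mk (ltn_ord k).
rewrite (mutate_uptoS a (Ordinal ltm)) ffunE -val_eqE /= gtn_eqF // IH //.
exact: ltnW.
Qed.

Lemma mutate_upto_lt a m (k : 'I_n) : (k < m)%N -> (m <= n)%N ->
  mutate_upto a m k = coxeter_mutation a k.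
Proof.
move=> km mn.
have -> : coxeter_mutation a = mutate_upto a (m + (n - m)).
  by rewrite subnKC // /mutate_upto take_oversize // size_enum_ord.
have: (m + (n - m) <= n)%N by rewrite subnKC.
elim: (n - m)%N => [|d IH]; first by rewrite addn0.
rewrite addnS => ltd; rewrite (mutate_uptoS a (Ordinal ltd)) ffunE -val_eqE /=.
by rewrite (IH (ltnW ltd)) ltn_eqF // ltn_addr.
Qed.

Lemma mutate_gt0 (a : {ffun 'I_n -> rat}) i : 
  (forall k, 0 < a k) -> forall k, 0 < mutate a i k.
Proof.
move=> a0 k; rewrite ffunE; case: ifP => // _.
rewrite divr_gt0 // addr_gt0 // mulr_gt0 //; exact: prodr_gt0.
Qed.

Lemma frieze0 i : frieze 0 i = 1.
Proof. by rewrite ffunE. Qed.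

Lemma frieze_gt0 t i : 0 < frieze t i.
Proof.
elim: t i => [|t IH] i; first by rewrite frieze0.
rewrite /frieze iterS -/(frieze t) /coxeter_mutation.
elim: (enum 'I_n) (frieze t) IH i => [|k s IHs] //= a a0.
exact/IHs/mutate_gt0.
Qed.

Hypothesis Qgt : forall i j, Q i j -> (j < i)%N.

Lemma frieze_rec t i :
  frieze t.+1 i * frieze t i =
    \prod_(j | Q j i) frieze t j * \prod_(k | Q i k) frieze t.+1 k + 1.
Proof.
rewrite {1}/frieze iterS -/(frieze t) -(@mutate_upto_lt (frieze t) i.+1) //.
rewrite mutate_uptoS ffunE eqxx (@mutate_upto_ge _ i i) //.
rewrite divfK ?gt_eqF ?frieze_gt0 //.
congr (_ * _ + 1); apply: eq_bigr => j Qj.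
  by rewrite mutate_upto_ge // ltnW // Qgt.
by rewrite mutate_upto_lt ?Qgt // ltnW.
Qed.

End Frieze.

(** * The quiver of affine type D with vertices 1, ..., n

   Vertices, variables and parameters are referred to by their 1-based labels:
   the vertex [k] is the ordinal of value [k.-1]. *)

Definition affD_arrow (n u v : nat) : bool :=
  [|| (u == 3) && (v == 1), (u == 3) && (v == 2),
      [&& 3 <= v, u <= n - 2 & u == v.+1],
      (u == n) && (v == n - 2) | (u == n - 1) && (v == n - 2)]%N.

Definition affD (n : nat) : rel 'I_n := fun i j => affD_arrow n i.+1 j.+1.

Lemma affD_gt n (i j : 'I_n) : (5 <= n)%N -> affD i j -> (j < i)%N.
Proof.
rewrite /affD => n5 uv; rewrite -ltnS; move: uv; rewrite /affD_arrow.
by move: i.+1 j.+1 => u v; lia.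
Qed.

Section Equations.
Variables (K : fieldType) (n : nat) (hn : (5 <= n)%N).

Definition vertex (k : nat) : 'I_n :=
  insubd (Ordinal (leq_trans (isT : (0 < 5)%N) hn)) k.-1.

Lemma vertexE k : (0 < k <= n)%N -> (vertex k).+1 = k.
Proof.
case/andP=> k0 kn; rewrite /vertex val_insubd.
by rewrite prednK // kn prednK.
Qed.

Lemma vertexK (i : 'I_n) : vertex i.+1 = i.
Proof. by apply: val_inj; rewrite val_insubd /= ltn_ord. Qed.

(* x_2 > ... > x_n > x_1 *)
Definition affD_lex : rel 'X_{1..n} := lex_le (rot 1 (enum 'I_n)).

Definition end_labels : seq nat := [:: 1; 2; n - 1; n]%N.

Variables a b c d e : nat -> K.

Definition alpha : K := a 1 * b n - a n * b 1.

Definition param (i : nat) (t : K) : K :=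
  if i \in end_labels then (a i * t ^+ 2 + b i) / t
  else (c i * t ^+ 4 + d i * t ^+ 2 + e i) / t ^+ 2.

Local Notation x_ k := ('X_(vertex k) : {mpoly K[n]}).

Definition Lfirst : {mpoly K[n]} := x_ 2 - x_ 1.

Definition Llast : {mpoly K[n]} := x_ (n - 1) - x_ n.

Definition Lmid (k : nat) : {mpoly K[n]} :=
  x_ k
  + ((a 1 * a n * e k - b 1 * b n * c k) / (a 1 * b 1 * alpha)) *: x_ 1 ^+ 2
  - ((a 1 ^+ 2 * e k - b 1 ^+ 2 * c k) / (a 1 * b 1 * alpha)) *: (x_ 1 * x_ n)
  + ((a 1 ^+ 2 * e k - a 1 * b 1 * d k + b 1 ^+ 2 * c k) / (a 1 * b 1))%:MP.

Definition Hpoly : {mpoly K[n]} :=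
  (a n * b n) *: x_ 1 ^+ 2 - (a 1 * b n + a n * b 1) *: (x_ 1 * x_ n)
  + (a 1 * b 1) *: x_ n ^+ 2 + (alpha ^+ 2)%:MP.

(* L_2, L_3, ..., L_(n-2), L_(n-1), H *)
Definition affD_basis : seq {mpoly K[n]} :=
  Lfirst :: [seq Lmid k | k <- iota 3 (n - 4)] ++ [:: Llast; Hpoly].

End Equations.

(* Main.v *)
(* The frieze has an explicit solution.  Put p = n - 3 and let V_0 = V_1 = 1,
   V_(k+2) = (p + 2) V_(k+1) - V_k.  At time m p the two end coordinates are
   V_(2m) and V_(2m+1), and both are affine in t on each block of length p; the
   middle coordinates are products of two values of the first one minus a
   constant depending only on t mod p.  If mu + 1/mu = p + 2 with mu > 1, then
   along t = s mod p all coordinates are Laurent polynomials in z = mu^(2m), of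
   the shape required, with all coefficients of the end coordinates nonzero and
   a_n = mu a_1, b_n = b_1 / mu.  The powers of mu^2 are infinitely many, so
   X(Q) is the union of p such curves.

   A curve of this shape is the zero locus of the L's and H, since t and 1/t are
   linear functions of (x_1, x_n) on it; hence it is closed, isomorphic to
   xy = 1, and smooth.  Modulo the L's and H every polynomial becomes
   f_0(x_1) + x_n f_1(x_1); if it vanishes on the curve, then the symmetry
   t -> b_1 / (a_1 t), which fixes x_1 but not x_n, forces f_1 = 0 and f_0 = 0. *)

Require Import Defs.
From mathcomp Require Import all_boot all_order all_algebra.
From mathcomp Require Import boolp classical_sets reals.
From mathcomp Require Import complex.
From mathcomp.multinomials Require Import mpoly.
From mathcomp Require Import ring zify.

Set Implicit Arguments.
Unset Strict Implicit.
Unset Printing Implicit Defensive.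

Import Order.TTheory GRing.Theory Num.Theory.
Local Open Scope ring_scope.
Local Open Scope classical_set_scope.

(** * The frieze of affine type D *)

Section Exchange.
Context {n : nat} (hn : (5 <= n)%N).

Definition affD_frieze (t v : nat) : rat := frieze (@affD n) t (vertex hn v).

Lemma eq_vertex (j : 'I_n) v : (0 < v <= n)%N -> (j == vertex hn v) = (j.+1 == v).
Proof. by move=> hv; rewrite -val_eqE /= -eqSS vertexE. Qed.

Lemma prod_vertex (F : 'I_n -> rat) (P : pred 'I_n) v : (0 < v <= n)%N ->
  (forall j, P j = (j.+1 == v)) -> \prod_(j | P j) F j = F (vertex hn v).
Proof.
by move=> hv PE; apply: big_pred1 => j; rewrite PE /= eq_vertex.
Qed.

Lemma prod_vertex2 (F : 'I_n -> rat) (P : pred 'I_n) v w :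
  (0 < v <= n)%N -> (0 < w <= n)%N -> v != w ->
  (forall j, P j = (j.+1 == v) || (j.+1 == w)) ->
  \prod_(j | P j) F j = F (vertex hn v) * F (vertex hn w).
Proof.
move=> hv hw vw PE; rewrite (bigD1 (vertex hn v)) ?PE /= ?vertexE ?eqxx //.
congr (_ * _); apply: prod_vertex => // j; rewrite PE eq_vertex //.
by move: vw; lia.
Qed.

Lemma affD_frieze_gt0 t v : 0 < affD_frieze t v.
Proof. exact: frieze_gt0. Qed.

Lemma affD_exchange t v :
  affD_frieze t.+1 v * affD_frieze t v =
  \prod_(j | affD j (vertex hn v)) frieze (@affD n) t j *
  \prod_(j | affD (vertex hn v) j) frieze (@affD n) t.+1 j + 1.
Proof. by apply: frieze_rec => i j; apply: affD_gt. Qed.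

Lemma affD_exchange_left t v : (1 <= v <= 2)%N ->
  affD_frieze t.+1 v * affD_frieze t v = affD_frieze t 3 + 1.
Proof.
move=> hv; rewrite affD_exchange (@prod_vertex _ _ 3); [|lia|]; last first.
  by move=> j; rewrite /affD vertexE /affD_arrow; lia.
by rewrite big_pred0 ?mulr1 // => j; rewrite /affD vertexE /affD_arrow; lia.
Qed.

Lemma affD_exchange_right t v : (n - 1 <= v <= n)%N ->
  affD_frieze t.+1 v * affD_frieze t v = affD_frieze t.+1 (n - 2) + 1.
Proof.
move=> hv; rewrite affD_exchange big_pred0 ?mul1r; last first.
  by move=> j; have := ltn_ord j; rewrite /affD vertexE /affD_arrow; lia.
rewrite (@prod_vertex _ _ (n - 2)) //; first lia.
by move=> j; have := ltn_ord j; rewrite /affD vertexE /affD_arrow; lia.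
Qed.

Lemma affD_exchange_mid t v : (3 <= v <= n - 2)%N ->
  affD_frieze t.+1 v * affD_frieze t v =
  (if v == (n - 2)%N then affD_frieze t (n - 1) * affD_frieze t n
   else affD_frieze t v.+1) *
  (if v == 3 then affD_frieze t.+1 1 * affD_frieze t.+1 2
   else affD_frieze t.+1 v.-1) + 1.
Proof.
move=> hv; rewrite affD_exchange; congr (_ * _ + 1); case: ifP => /eqP vE.
- rewrite (@prod_vertex2 _ _ (n - 1) n) //; [lia..|].
  by move=> j; have := ltn_ord j; rewrite /affD vertexE /affD_arrow; lia.
- rewrite (@prod_vertex _ _ v.+1) //; [lia|].
  by move=> j; have := ltn_ord j; rewrite /affD vertexE /affD_arrow; lia.
- rewrite (@prod_vertex2 _ _ 1 2) //; [lia..|].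
  by move=> j; have := ltn_ord j; rewrite /affD vertexE /affD_arrow; lia.
- rewrite (@prod_vertex _ _ v.-1) //; [lia|].
  by move=> j; have := ltn_ord j; rewrite /affD vertexE /affD_arrow; lia.
Qed.

End Exchange.

(** * Closed formulas for the frieze coordinates *)

Section Solution.
Variable K : numFieldType.

Section Segment.
Variable p : nat.
Local Notation P := (p%:R : K).

(* The first frieze coordinate is affine in t on each block [m p, (m + 1) p];
   (x, y) are the first and last coordinates at t = m p, and [next x y] is the
   first one at t = (m + 1) p. *)
Definition segment (x y s : K) : K := x + s * ((P + 2) * y - 2 * x) / P.

Definition next (x y : K) : K := (P + 2) * y - x.

(* The value at the vertex j + 2 and the time m p + s.  It has the form
   u_(t+j) u_t - k, where k is the continuant of the quotients
   (u_(r+1) + u_(r-1)) / u_r for t < r < t + j; these quotients are 2, except at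
   the block boundary, where they are p + 6. *)
Definition arc (x y : K) (j s : nat) : K :=
  if (s + j <= p)%N then
    segment x y (s%:R + j%:R) * segment x y s%:R - j%:R
  else
    segment (next x y) (next y (next x y)) (s%:R + j%:R - P) * segment x y s%:R
    - (j%:R + (P + 4) * (P - s%:R) * (s%:R + j%:R - P)).

Hypothesis p0 : P != 0.

(** At s + j = p the two branches agree: the old segment ends where the next one begins, and the
    last correction term vanishes. So the second formula also covers the boundary. *)
Lemma arc_ge x y j s : (p <= s + j)%N -> arc x y j s =
  segment (next x y) (next y (next x y)) (s%:R + j%:R - P) * segment x y s%:R
    - (j%:R + (P + 4) * (P - s%:R) * (s%:R + j%:R - P)).
Proof.
rewrite /arc; case: ifP => // le_sp le_ps.
have -> : j%:R = P - s%:R by rewrite -natrB; [congr _%:R|]; lia.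
by rewrite /segment /next; field.
Qed.

Lemma segment_end x y : segment x y P = next x y.
Proof. by rewrite /segment /next; field. Qed.

Lemma arc0 x y s : (s <= p)%N -> arc x y 0 s = segment x y s%:R ^+ 2.
Proof. by move=> sp; rewrite /arc addn0 sp addr0 subr0 expr2. Qed.

Lemma arc1 x y s : (s < p)%N ->
  segment x y s.+1%:R * segment x y s%:R = arc x y 1 s + 1.
Proof. by move=> sp; rewrite /arc addn1 sp -natr1 subrK. Qed.

Lemma arc_exchange x y j s : (s < p)%N -> (j <= p)%N ->
  arc x y j.+1 s.+1 * arc x y j.+1 s = arc x y j.+2 s * arc x y j s.+1 + 1.
Proof.
(* The four arcs end at s + j + 1 or s + j + 2, so either all are in the first branch or all meet
   the bound of [arc_ge]. *)
move=> sp jp; case: (leqP (s + j.+2) p) => h.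
  by rewrite /arc !ifT; [rewrite /segment -!natr1; field|lia..].
by rewrite !arc_ge; [rewrite /segment /next -!natr1; field|lia..].
Qed.

(** The two sides differ by a multiple of x^2 + y^2 - (P + 2) x y + P, which is zero by hypothesis;
    the explicit cofactor leaves an identity of rational functions. [arc_pred_end] works the same
    way. *)
Lemma arc_end x y s : x ^+ 2 + y ^+ 2 - (P + 2) * x * y = - P ->
  arc x y p s = segment y (next x y) s%:R ^+ 2.
Proof.
move=> I; rewrite arc_ge; last lia.
apply/eqP; rewrite -subr_eq0; apply/eqP.
transitivity ((x ^+ 2 + y ^+ 2 - (P + 2) * x * y + P) *
  ((P + 4) / P * s%:R * (s%:R - P) - 1)); first by rewrite /segment /next; field.
by rewrite I addNr mul0r.
Qed.

Lemma arc_pred_end x y s : (0 < p)%N ->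
  x ^+ 2 + y ^+ 2 - (P + 2) * x * y = - P ->
  segment y (next x y) s.+1%:R * segment y (next x y) s%:R =
  arc x y p.-1 s.+1 + 1.
Proof.
move=> pp I; rewrite arc_ge; last lia.
have -> : p.-1%:R = P - 1 :> K by rewrite -subn1 natrB.
apply/eqP; rewrite -subr_eq0; apply/eqP; rewrite -!natr1.
transitivity ((x ^+ 2 + y ^+ 2 - (P + 2) * x * y + P) *
  (1 - 2 / P - (P + 4) / P * s%:R * (s%:R - P + 1))); first by rewrite /segment /next; field.
by rewrite I addNr mul0r.
Qed.

(** At s = p the factor P - s kills the block-boundary correction, and [segment x y P] is the
    starting value of the next block. *)
Lemma arc_shift x y j : (j <= p)%N ->
  arc x y j p = arc (next x y) (next y (next x y)) j 0.
Proof.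
move=> jp; rewrite arc_ge; last lia.
by rewrite {1}/arc jp segment_end /segment; field.
Qed.

(* [V p m.*2] and [V p m.*2.+1] are the first and last frieze coordinates at t = m p. *)
Fixpoint interleaved k : K * K :=
  if k is k'.+1 then ((interleaved k').2, next (interleaved k').1 (interleaved k').2)
  else (1, 1).

Definition V k : K := (interleaved k).1.

Lemma VSS k : V k.+2 = next (V k) (V k.+1). Proof. by []. Qed.

(** For fixed y, two values of x giving the form the same value have sum (P + 2) y, and [next]
    exchanges them. At (1, 1) the form equals - P. *)
Lemma V_invariant k : V k ^+ 2 + V k.+1 ^+ 2 - (P + 2) * V k * V k.+1 = - P.
Proof.
elim: k => [|k IH]; first by rewrite /V /=; ring.
by rewrite -IH VSS /next; ring.
Qed.

End Segment.

Variables (n : nat) (hn : (5 <= n)%N).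
Local Notation p := (n - 3)%N.

(** Middle vertices use j = v - 2, from 1 to p - 1. The extra cases j = 0 and j = p of [arc] are the
    products of the two left and of the two right end coordinates, so [arc_exchange] serves every
    middle vertex. *)
Definition affD_solution (x y : K) (s v : nat) : K :=
  if (v <= 2)%N then segment p x y s%:R
  else if (n - 1 <= v)%N then segment p y (next p x y) s%:R
  else arc p x y (v - 2) s.

Let p0 : (p%:R : K) != 0.
Proof. by rewrite pnatr_eq0; lia. Qed.

Lemma affD_solution_left x y s v : (v <= 2)%N ->
  affD_solution x y s v = segment p x y s%:R.
Proof. by rewrite /affD_solution => ->. Qed.

Lemma affD_solution_right x y s v : (n - 1 <= v)%N ->
  affD_solution x y s v = segment p y (next p x y) s%:R.
Proof. by move=> nv; rewrite /affD_solution nv ifF //; lia. Qed.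

Lemma affD_solution_mid x y s v : (3 <= v <= n - 2)%N ->
  affD_solution x y s v = arc p x y (v - 2) s.
Proof. by move=> hv; rewrite /affD_solution !ifF //; lia. Qed.

(** The exchange relation at v involves new values only at v itself and at smaller vertices, hence
    the strong induction on v; the old value at v is positive and can be cancelled. *)
Lemma affD_solution_step x y s t : (s < p)%N ->
  x ^+ 2 + y ^+ 2 - (p%:R + 2) * x * y = - p%:R ->
  (forall v, (0 < v <= n)%N -> ratr (affD_frieze hn t v) = affD_solution x y s v) ->
  forall v, (0 < v <= n)%N -> ratr (affD_frieze hn t.+1 v) = affD_solution x y s.+1 v.
Proof.
move=> sp inv IHt; elim/ltn_ind => v IHv hv.
have fneq0 : ratr (affD_frieze hn t v) != 0 :> K.
  by rewrite fmorph_eq0 gt_eqF // affD_frieze_gt0.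
apply: (mulIf fneq0); rewrite -rmorphM /= IHt //.
have [v2|v2] := leqP v 2.
  rewrite affD_exchange_left; last lia.
  rewrite rmorphD rmorph1 /= IHt; last lia.
  by rewrite !(@affD_solution_left _ _ _ v) // affD_solution_mid ?arc1 //; lia.
have [nv|vn] := leqP (n - 1) v.
  rewrite affD_exchange_right; last lia.
  rewrite rmorphD rmorph1 /= IHv; [|lia..].
  rewrite !(@affD_solution_right _ _ _ v) // affD_solution_mid; last lia.
  by rewrite arc_pred_end //; [congr (arc _ _ _ _ _ + 1)|]; lia.
rewrite affD_exchange_mid; last lia.
rewrite rmorphD rmorph1 rmorphM /= !(@affD_solution_mid _ _ _ v); [|lia..].
have -> : (v - 2 = (v - 3).+1)%N by lia.
rewrite arc_exchange //; last lia.
congr (_ * _ + 1); case: eqP => hv'.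
- rewrite rmorphM /= !IHt; [|lia..].
  rewrite !affD_solution_right; [|lia..].
  by rewrite -expr2 -arc_end //; congr arc; lia.
- rewrite IHt ?affD_solution_mid; [|lia..].
  by congr arc; lia.
- rewrite rmorphM /= !IHv; [|lia..].
  rewrite !affD_solution_left // -expr2 -arc0 //.
  by congr arc; lia.
- rewrite IHv ?affD_solution_mid; [|lia..].
  by congr arc; lia.
Qed.

Lemma affD_solution_shift x y v : (0 < v <= n)%N ->
  affD_solution x y p v =
  affD_solution (next p x y) (next p y (next p x y)) 0 v.
Proof.
move=> hv; rewrite /affD_solution; case: ifP => _.
  by rewrite segment_end // /segment !mul0r addr0.
case: ifP => nv; first by rewrite segment_end // /segment !mul0r addr0.
by rewrite arc_shift //; lia.
Qed.

Lemma ratr_affD_frieze m s v : (s < p)%N -> (0 < v <= n)%N ->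
  ratr (affD_frieze hn (m * p + s) v) =
  affD_solution (V p m.*2) (V p m.*2.+1) s v.
Proof.
(* Admitting s = p lets the inner induction reach the end of the block, which [affD_solution_shift]
   identifies with the start of the next. *)
move=> sp hv; have {sp} : (s <= p)%N by lia.
elim: m s v hv => [|m IHm] s.
  elim: s => [|s IHs] v hv sp; last first.
    rewrite addnS; apply: affD_solution_step => //; first exact: V_invariant.
    by move=> w hw; apply: IHs => //; lia.
  (* At time 0 the first branch with x = y = 1 gives (1 + j) - j = 1. *)
  rewrite /affD_frieze frieze0 rmorph1 /affD_solution /V /=.
  rewrite /segment /arc !mul0r !addr0.
  case: ifP => // _; case: ifP => // nv.
  by rewrite ifT; [rewrite /segment; field|lia].
elim: s => [|s IHs] v hv sp; last first.
  rewrite addnS; apply: affD_solution_step => //; first exact: V_invariant.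
  by move=> w hw; apply: IHs => //; lia.
by rewrite addn0 mulSn addnC IHm // affD_solution_shift // doubleS !VSS.
Qed.

End Solution.

(** * Zariski closed sets and rational curves *)

Section Zariski.
Context {K : fieldType} {n : nat}.
Implicit Types (A Z : set ('I_n -> K)) (f : {mpoly K[n]}).

Lemma zariski_closed_separate Z x : zariski_closed Z -> ~ Z x ->
  exists2 f, vanishing_ideal Z f & f.@[x] != 0.
Proof.
move=> [S ->] /existsNP[f /not_implyP[Sf fx]]; exists f; last exact/eqP.
by move=> y; apply.
Qed.

Lemma zariski_closedI Z1 Z2 : zariski_closed Z1 -> zariski_closed Z2 ->
  zariski_closed (Z1 `&` Z2).
Proof.
move=> [S1 ->] [S2 ->]; exists (S1 `|` S2); apply/seteqP; split=> x /=.
  by move=> [h1 h2] f [/h1|/h2].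
by move=> h; split=> f Sf; apply: h; [left|right].
Qed.

Lemma zariski_closedU Z1 Z2 : zariski_closed Z1 -> zariski_closed Z2 ->
  zariski_closed (Z1 `|` Z2).
Proof.
move=> c1 c2.
exists [set f | exists g h, [/\ vanishing_ideal Z1 g, vanishing_ideal Z2 h & f = g * h]].
apply/seteqP; split=> x.
  move=> Zx f [g [h [g0 h0 ->]]]; rewrite mevalM.
  by case: Zx => [/g0|/h0] ->; rewrite ?mul0r ?mulr0.
move=> hx; apply: contrapT => /not_orP[].
move=> /(zariski_closed_separate c1)[g g0 gx] /(zariski_closed_separate c2)[h h0 hx'].
have /eqP := hx (g * h) (ex_intro _ g (ex_intro _ h (And3 g0 h0 erefl))).
by rewrite mevalM mulf_eq0 (negPf gx) (negPf hx').
Qed.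

Lemma zariski_closed0 : @zariski_closed K n set0.
Proof.
exists [set 1]; apply/seteqP; split=> // x /(_ 1 erefl) /eqP.
by rewrite meval1 oner_eq0.
Qed.

Lemma zariski_closed_pt (x : 'I_n -> K) : zariski_closed [set x].
Proof.
exists (range (fun i => 'X_i - (x i)%:MP)); apply/seteqP; split=> y.
  by move=> -> _ [i _ <-]; rewrite mevalB mevalXU mevalC subrr.
move=> hy; apply/funext => i; apply/eqP; rewrite -subr_eq0; apply/eqP.
by rewrite -(hy ('X_i - (x i)%:MP)) ?mevalB ?mevalXU ?mevalC //; exists i.
Qed.

Lemma zariski_closed_bigU (Z : nat -> set ('I_n -> K)) p :
  (forall i, zariski_closed (Z i)) ->
  zariski_closed [set x | exists2 i, (i < p)%N & Z i x].
Proof.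
move=> cZ; elim: p => [|p IH].
  rewrite (_ : [set _ | _] = set0); first exact: zariski_closed0.
  by apply/seteqP; split=> // x [].
rewrite (_ : [set _ | _] = [set x | exists2 i, (i < p)%N & Z i x] `|` Z p).
  exact: zariski_closedU.
apply/seteqP; split=> x.
  case=> i; rewrite ltnS leq_eqVlt => /orP[/eqP-> Zx|ip Zx]; first by right.
  by left; eexists; eauto.
by case=> [[i ip Zx]|Zx]; [exists i => //; apply: ltnW|exists p].
Qed.

Lemma irreducible_subU Z Z1 Z2 : irreducible Z ->
  zariski_closed Z1 -> zariski_closed Z2 -> Z `<=` Z1 `|` Z2 ->
  Z `<=` Z1 \/ Z `<=` Z2.
Proof.
move=> [cZ _ irrZ] c1 c2 sub.
have : Z = (Z `&` Z1) `|` (Z `&` Z2).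
  by rewrite -setIUr; apply/esym/setIidPl.
move=> /irrZ[||->|->]; [exact: zariski_closedI|exact: zariski_closedI| |].
- by left; apply: subIsetr.
- by right; apply: subIsetr.
Qed.

Lemma irreducible_sub_bigU Z (W : nat -> set ('I_n -> K)) p : irreducible Z ->
  (forall i, zariski_closed (W i)) ->
  Z `<=` [set x | exists2 i, (i < p)%N & W i x] ->
  exists2 i, (i < p)%N & Z `<=` W i.
Proof.
move=> irrZ cW; elim: p => [|p IH] sub.
  by have [_ [x Zx] _] := irrZ; have [] := sub x Zx.
have : Z `<=` [set x | exists2 i, (i < p)%N & W i x] `|` W p.
  move=> x /sub[j]; rewrite ltnS leq_eqVlt => /orP[/eqP-> Wx|jp Wx]; first by right.
  by left; eexists; eauto.
move=> /irreducible_subU[|||/IH[i ip ZW]|ZW] //; first exact: zariski_closed_bigU.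
  by exists i => //; apply: ltnW.
by exists p.
Qed.

Lemma irreducible_pt (x : 'I_n -> K) : irreducible [set x].
Proof.
split; [exact: zariski_closed_pt|by exists x|].
move=> Z1 Z2 _ _ xZ; have : [set x] x by [].
have sub1 (A : set ('I_n -> K)) : A x -> A `<=` [set x] -> [set x] = A.
  by move=> Ax sA; apply/seteqP; split=> // y ->.
by rewrite {1}xZ => -[/sub1 h|/sub1 h]; [left|right]; apply: h; rewrite xZ;
  [apply: subsetUl|apply: subsetUr].
Qed.

Lemma zariski_closure_closed A : zariski_closed A -> zariski_closure A = A.
Proof.
move=> cA; apply/seteqP; split=> [x|x Ax B [_]]; last exact.
by apply; split.
Qed.

(** The differential of [f] at [x] applied to [v]; its vanishing on the ideal defines
    [tangent_space]. *)
Definition directional (x v : 'I_n -> K) f : K := \sum_i f^`M(i).@[x] * v i.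

Lemma directionalC x v c : directional x v c%:MP = 0.
Proof. by rewrite /directional big1 // => i _; rewrite mderivC meval0 mul0r. Qed.

Lemma directionalD x v f g :
  directional x v (f + g) = directional x v f + directional x v g.
Proof.
by rewrite /directional -big_split; apply: eq_bigr => i _ /=; rewrite mderivD mevalD mulrDl.
Qed.

Lemma directionalZ x v c f : directional x v (c *: f) = c * directional x v f.
Proof.
by rewrite /directional mulr_sumr; apply: eq_bigr => i _; rewrite mderivZ mevalZ mulrA.
Qed.

Lemma directionalN x v f : directional x v (- f) = - directional x v f.
Proof. by rewrite -scaleN1r directionalZ mulN1r. Qed.

Lemma directionalM x v f g :
  directional x v (f * g) = directional x v f * g.@[x] + f.@[x] * directional x v g.
Proof.
rewrite /directional mulr_suml mulr_sumr -big_split; apply: eq_bigr => i _ /=.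
by rewrite mderivM mevalD !mevalM; ring.
Qed.

Lemma directionalX x v i : directional x v 'X_i = v i.
Proof.
have UU : (U_(i) - U_(i))%MM = 0%MM by apply/mnmP => k; rewrite mnmBE subnn mnm0E.
rewrite /directional (bigD1 i) //= mderivX mnm1E eqxx scale1r UU mpolyX0 meval1 mul1r.
rewrite big1 ?addr0 // => j ji.
by rewrite mderivX mnm1E eq_sym (negPf ji) scale0r meval0 mul0r.
Qed.

End Zariski.

Lemma poly_injective_roots (K : idomainType) (F : {poly K}) (z : nat -> K) :
  injective z -> (forall m, F.[z m] = 0) -> F = 0.
Proof.
move=> z_inj Fz; apply: (@roots_geq_poly_eq0 _ _ (mkseq z (size F))).
- by apply/allP => _ /mapP[m _ ->]; apply/rootP.
- exact: mkseq_uniq.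
- by rewrite size_mkseq.
Qed.

Lemma poly_finite_roots (K : fieldType) (F : {poly K}) : F != 0 ->
  exists s : seq K, forall t, root F t -> t \in s.
Proof.
have [k] := ubnP (size F); elim: k F => // k IH F szF F0.
have [[r /factor_theorem[H FE]]|noroot] := EM (exists r, root F r); last first.
  by exists [::] => t Ft; case: noroot; exists t.
have H0 : H != 0 by apply: contraNneq F0 => H0; rewrite FE H0 mul0r.
have [|s sP] := IH H _ H0.
  move: szF; rewrite FE size_Mmonic ?monicXsubC // size_XsubC addn2 /=.
  by rewrite ltnS.
exists (r :: s) => t; rewrite FE rootM root_XsubC inE => /orP[/sP->|->] //.
by rewrite orbT.
Qed.

(** * Curves with Laurent polynomial coordinates *)

Section LaurentCurve.
Context {K : numFieldType} {n : nat}.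
Variable G : 'I_n -> {poly K}.

Definition curve (t : K) : 'I_n -> K := fun i => (G i).[t] / t ^+ 2.

(** The derivative of [curve] in t, over the denominator t^3. *)
Definition velocity (t : K) : 'I_n -> K :=
  fun i => ((G i)^`().[t] * t - (G i).[t] * 2) / t ^+ 3.

Definition curve_image : set ('I_n -> K) :=
  [set x | exists2 t, t != 0 & x = curve t].

(* The second identity is [t * D (t^N f) = t^N.+1 * D f + N t^N f] along the curve. *)
Lemma curve_pullback (f : {mpoly K[n]}) : exists (N : nat) (F : {poly K}),
  forall t : K, t != 0 -> f.@[curve t] * t ^+ N = F.[t] /\
    directional (curve t) (velocity t) f * t ^+ N.+1 = F^`().[t] * t - F.[t] * N%:R.
Proof.
pose PB f := exists (N : nat) (F : {poly K}),
  forall t : K, t != 0 -> f.@[curve t] * t ^+ N = F.[t] /\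
    directional (curve t) (velocity t) f * t ^+ N.+1 = F^`().[t] * t - F.[t] * N%:R.
have PBC c : PB c%:MP.
  exists 0, c%:P => t t0; rewrite mevalC directionalC derivC !hornerC.
  by split; ring.
have PBM f1 f2 : PB f1 -> PB f2 -> PB (f1 * f2).
  move=> [N1 [F1 h1]] [N2 [F2 h2]]; exists (N1 + N2)%N, (F1 * F2) => t t0.
  have [e1 d1] := h1 t t0; have [e2 d2] := h2 t t0.
  rewrite mevalM directionalM derivM !hornerE -e1 -e2; split.
    by rewrite exprD; ring.
  transitivity (directional (curve t) (velocity t) f1 * t ^+ N1.+1 * (f2.@[curve t] * t ^+ N2)
    + (f1.@[curve t] * t ^+ N1) * (directional (curve t) (velocity t) f2 * t ^+ N2.+1)).
    by rewrite !exprS exprD; ring.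
  by rewrite d1 d2 e1 e2 natrD; ring.
have PBD f1 f2 : PB f1 -> PB f2 -> PB (f1 + f2).
  move=> [N1 [F1 h1]] [N2 [F2 h2]].
  exists (N1 + N2)%N, (F1 * 'X^N2 + F2 * 'X^N1) => t t0.
  have [e1 d1] := h1 t t0; have [e2 d2] := h2 t t0.
  (* At m = 0 the truncated exponent [m.-1] is harmless, since the multiplicity is 0. *)
  have expX m : (t ^+ m.-1 *+ m) * t = m%:R * t ^+ m.
    by case: m => [|m]; rewrite ?mul0r // -mulr_natl -mulrA -exprSr.
  rewrite mevalD directionalD derivD !derivM !derivXn !(hornerD, hornerM, hornerMn, hornerXn).
  split; first by rewrite -e1 -e2 exprD; ring.
  transitivity (directional (curve t) (velocity t) f1 * t ^+ N1.+1 * t ^+ N2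
    + directional (curve t) (velocity t) f2 * t ^+ N2.+1 * t ^+ N1).
    by rewrite !exprS exprD; ring.
  rewrite d1 d2 natrD.
  transitivity ((F1^`().[t] * t - F1.[t] * N1%:R) * t ^+ N2 +
    (F2^`().[t] * t - F2.[t] * N2%:R) * t ^+ N1 +
    F1.[t] * ((t ^+ N2.-1 *+ N2) * t - N2%:R * t ^+ N2) +
    F2.[t] * ((t ^+ N1.-1 *+ N1) * t - N1%:R * t ^+ N1)); last first.
    by move: (t ^+ N1.-1 *+ N1) (t ^+ N2.-1 *+ N2) => A B; ring.
  by rewrite !expX !subrr !mulr0 !addr0.
have PBX i : PB 'X_i.
  exists 2%N, (G i) => t t0; rewrite mevalXU directionalX /curve /velocity.
  by rewrite !divfK ?expf_neq0.
have PBXm m : PB 'X_[m].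
  rewrite mpolyXE_id; apply: big_ind => [|f1 f2|i _]; [exact: (PBC 1)|exact: PBM|].
  by elim: (m i) => [|k IH]; [exact: (PBC 1)|rewrite exprS; apply: PBM].
elim/mpolyind: f => [|c m f _ _ IH]; first exact: (PBC 0).
by apply: PBD => //; rewrite -mul_mpolyC; apply: PBM.
Qed.

(** The numerator of [f] along the curve has infinitely many roots, hence is zero. *)
Lemma curve_dense (f : {mpoly K[n]}) (z : nat -> K) :
  injective z -> (forall m, z m != 0) -> (forall m, f.@[curve (z m)] = 0) ->
  vanishing_ideal curve_image f.
Proof.
move=> z_inj z0 fz _ [t t0 ->]; have [N [F FE]] := curve_pullback f.
have F0 : F = 0.
  by apply: (poly_injective_roots z_inj) => m; have [<- _] := FE _ (z0 m); rewrite fz mul0r.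
have [/eqP] := FE t t0; rewrite F0 horner0 mulf_eq0 expf_eq0 (negPf t0) andbF orbF.
by move=> /eqP.
Qed.

(** The numerator of [f] along the curve vanishes at all positive integers, so it and its derivative
    are zero; the second identity of [curve_pullback] concludes. *)
Lemma curve_velocity_tangent (f : {mpoly K[n]}) t : t != 0 ->
  vanishing_ideal curve_image f -> directional (curve t) (velocity t) f = 0.
Proof.
move=> t0 fC; have [N [F FE]] := curve_pullback f.
have F0 : F = 0.
  apply: (@poly_injective_roots _ _ (fun m => m.+1%:R)) => [i j /eqP|m].
    by rewrite eqr_nat eqSS => /eqP.
  have m0 : m.+1%:R != 0 :> K by rewrite pnatr_eq0.
  by have [<- _] := FE _ m0; rewrite fC ?mul0r //; exists m.+1%:R.
have [_ /eqP] := FE t t0.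
by rewrite F0 deriv0 horner0 !mul0r subr0 mulf_eq0 expf_eq0 (negPf t0) andbF orbF => /eqP.
Qed.

(* A proper closed subset of the curve lies over the roots of one polynomial. *)
Lemma curve_closed_proper (W : set ('I_n -> K)) :
  zariski_closed W -> ~ curve_image `<=` W ->
  exists2 F : {poly K}, F != 0 & forall t : K, t != 0 -> W (curve t) -> root F t.
Proof.
move=> cW /existsNP[x /not_implyP[[t t0 ->]]] /(zariski_closed_separate cW)[f fW ft].
have [N [F FE]] := curve_pullback f; exists F.
  apply: contraNneq ft => F0; have [/eqP] := FE t t0.
  by rewrite F0 horner0 mulf_eq0 expf_eq0 (negPf t0) andbF orbF.
by move=> s s0 /fW fs; apply/rootP; have [<- _] := FE s s0; rewrite fs mul0r.
Qed.

Hypothesis curve_closed : zariski_closed curve_image.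

(** If neither closed set contained the curve, each would lie over the roots of a nonzero
    polynomial, and the product of the two would vanish at all positive integers. *)
Lemma curve_irreducible : irreducible curve_image.
Proof.
split=> //; first by exists (curve 1), 1; rewrite ?oner_neq0.
move=> Z1 Z2 c1 c2 CE.
have [s1|/(curve_closed_proper c1)[F1 F10 F1W]] := EM (curve_image `<=` Z1).
  by left; apply/seteqP; split=> //; rewrite CE; apply: subsetUl.
have [s2|/(curve_closed_proper c2)[F2 F20 F2W]] := EM (curve_image `<=` Z2).
  by right; apply/seteqP; split=> //; rewrite CE; apply: subsetUr.
have : F1 * F2 = 0.
  apply: (@poly_injective_roots _ _ (fun m => m.+1%:R)) => [i j /eqP|m].
    by rewrite eqr_nat eqSS => /eqP.
  have m0 : m.+1%:R != 0 :> K by rewrite pnatr_eq0.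
  have : curve_image (curve m.+1%:R) by exists m.+1%:R.
  by rewrite CE hornerM => -[/(F1W _ m0)|/(F2W _ m0)] /rootP ->; rewrite ?mul0r ?mulr0.
by move=> /eqP; rewrite mulf_eq0 (negPf F10) (negPf F20).
Qed.

(** A proper closed subset lies over finitely many parameters, so finitely many points cover it and
    irreducibility selects one. *)
Lemma curve_irreducible_proper W : irreducible W -> W `<=` curve_image ->
  W <> curve_image -> exists x, W = [set x].
Proof.
move=> irrW WC WneC; have [cW [y Wy] _] := irrW.
have nCW : ~ curve_image `<=` W by move=> CW; apply: WneC; apply/seteqP.
have [F F0 FW] := curve_closed_proper cW nCW.
have [s Fs] := poly_finite_roots F0.
have [||i _ WW] := @irreducible_sub_bigU _ _ W (fun i => [set curve (nth 0 s i)]) (size s) irrW.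
- by move=> i; apply: zariski_closed_pt.
- move=> x Wx; have [t t0 xE] := WC _ Wx; have ts : t \in s by apply/Fs/FW => //; rewrite -xE.
  by exists (index t s); rewrite ?index_mem //= nth_index.
- exists (curve (nth 0 s i)); apply/seteqP; split=> // _ ->.
  by rewrite -(WW _ Wy).
Qed.

(** Two distinct points show that a point is a proper subset of the curve. In a longer chain [W 1]
    would be a single point, with no room for a smaller nonempty [W 0]. *)
Lemma curve_dimension x y : curve_image x -> curve_image y -> x <> y ->
  has_dimension curve_image 1.
Proof.
move=> Cx Cy xy; have neq : [set x] <> curve_image.
  by move=> CE; move: Cy; rewrite -CE => /esym.
split.
  exists (fun i => if i is 0 then [set x] else curve_image); split.
    by case=> [|i] _; split=> //; [exact: irreducible_pt|move=> _ ->|exact: curve_irreducible].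
  case=> // _; rewrite properEneq; split; first exact/eqP.
  by move=> _ ->.
move=> d [W [irrW ltW]]; rewrite leqNgt; apply/negP => d1.
have [W0 _] := irrW 0 (leq0n d).
have [W1 W1C] := irrW 1 (ltnW d1); have [_ W2C] := irrW 2 d1.
have [W01 nW10] := ltW 0 (ltnW d1); have [W12 nW21] := ltW 1 d1.
have [z W1E] : exists z, W 1 = [set z].
  by apply: curve_irreducible_proper => // W1E; apply: nW21; rewrite W1E.
have [_ [w Ww] _] := W0; apply: nW10 => v; rewrite W1E => ->.
by move: (W01 _ Ww); rewrite W1E => <-.
Qed.

End LaurentCurve.

(** * The curves of affine type D *)

Section LexGroebner.
Context {K : fieldType} {n : nat}.

Lemma generated_ideal_mul (S : set {mpoly K[n]}) h g : S g -> generated_ideal S (h * g).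
Proof.
move=> Sg; exists [:: (h, g)]; rewrite big_seq1; split=> // u.
by rewrite inE => /eqP ->.
Qed.

Lemma generated_ideal_sub (S T : set {mpoly K[n]}) :
  S `<=` generated_ideal T -> generated_ideal S `<=` generated_ideal T.
Proof.
move=> ST f [r [rS ->]]; elim: r rS => [|[h g] r IH] rS.
  by exists [::]; rewrite !big_nil.
have [|r2 [r2T r2E]] := IH; first by move=> u ur; apply: rS; rewrite inE ur orbT.
have [r1 [r1T /= ->]] := ST g (rS (h, g) (mem_head _ _)).
exists ([seq (h * u.1, u.2) | u <- r1] ++ r2); split.
  by move=> u; rewrite mem_cat => /orP[/mapP[v /r1T Tv ->]|/r2T].
rewrite big_cons big_cat r2E big_map /= mulr_sumr; congr (_ + _).
by apply: eq_bigr => u _; rewrite mulrA.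
Qed.

Lemma lex_le_catl (s1 s2 : seq 'I_n) i (m m' : 'X_{1..n}) :
  {in s1, forall j, m' j = m j} -> (m' i < m i)%N -> lex_le (s1 ++ i :: s2) m' m.
Proof.
rewrite /lex_le => ms1 mi; elim: s1 ms1 => [|j s1 IH] ms1 /=.
  by rewrite lexi_cons leEnat (ltnW mi) /= leqNgt mi.
rewrite ms1 ?mem_head // eqhead_lexiE IH // => k ks.
by apply: ms1; rewrite inE ks orbT.
Qed.

(** The elimination property of the lexicographic order. *)
Lemma lex_le_cat0 (s1 s2 : seq 'I_n) (m m' : 'X_{1..n}) :
  lex_le (s1 ++ s2) m' m -> {in s1, forall j, m j = 0%N} ->
  {in s1, forall j, m' j = 0%N} /\ lex_le s2 m' m.
Proof.
rewrite /lex_le; elim: s1 => [|j s1 IH] //= le ms1.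
have mj := ms1 j (mem_head _ _).
move: le; rewrite lexi_cons leEnat mj leqn0 => /andP[/eqP m'j]; rewrite m'j /=.
move=> /IH[|h1 h2]; first by move=> k ks; apply: ms1; rewrite inE ks orbT.
by split=> // k; rewrite inE => /orP[/eqP ->|/h1].
Qed.

End LexGroebner.

Section AffDLex.
Context {K : fieldType} {n : nat} (hn : (5 <= n)%N).
Local Notation vtx := (vertex hn).

Lemma vertex_inj k l : (0 < k <= n)%N -> (0 < l <= n)%N -> (vtx k == vtx l) = (k == l).
Proof. by move=> hk hl; rewrite eq_vertex // vertexE. Qed.

Lemma end_labelsE v : (v \in end_labels n) = [|| v == 1, v == 2, v == n - 1 | v == n]%N.
Proof. by rewrite !inE. Qed.

Lemma vertex_ext (x y : 'I_n -> K) :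
  (forall k, (0 < k <= n)%N -> x (vtx k) = y (vtx k)) -> x = y.
Proof.
by move=> xy; apply/funext => i; rewrite -(vertexK hn i) xy //= ltn_ord.
Qed.

Lemma label_cases k : (0 < k <= n)%N ->
  k \in end_labels n \/ (3 <= k <= n - 2)%N.
Proof. by rewrite end_labelsE; lia. Qed.

Lemma affD_lex_seq :
  rot 1 (enum 'I_n) = [seq vtx k | k <- iota 2 n.-1] ++ [:: vtx 1].
Proof.
have -> : enum 'I_n = [seq vtx k | k <- iota 1 n].
  apply: (inj_map val_inj); rewrite val_enum_ord -map_comp.
  rewrite -[1%N]/(1 + 0)%N iotaDl -map_comp -[LHS]map_id.
  apply/eq_in_map => k; rewrite mem_iota /= => kn.
  by apply: succn_inj; rewrite vertexE.
by case: n hn => // n' hn'; rewrite /= rot1_cons cats1.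
Qed.

Lemma affD_lex_lt k (m m' : 'X_{1..n}) : (2 <= k <= n)%N ->
  (forall j, (2 <= j < k)%N -> m' (vtx j) = m (vtx j)) ->
  (m' (vtx k) < m (vtx k))%N -> affD_lex m' m.
Proof.
move=> hk mj mk; rewrite /affD_lex affD_lex_seq.
have -> : n.-1 = ((k - 2) + (n - k).+1)%N by lia.
rewrite iotaD map_cat /= (_ : 2 + (k - 2) = k)%N; last lia.
rewrite -catA cat_cons; apply: lex_le_catl => // _ /mapP[j jk ->].
by apply: mj; move: jk; rewrite mem_iota; lia.
Qed.

(** Elimination of x_2, ..., x_(n-1); the next variable compared is x_n, which bounds its
    exponent. *)
Lemma affD_lex_le0 (m m' : 'X_{1..n}) : affD_lex m' m ->
  (forall k, (2 <= k < n)%N -> m (vtx k) = 0%N) ->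
  (forall k, (2 <= k < n)%N -> m' (vtx k) = 0%N) /\ (m' (vtx n) <= m (vtx n))%N.
Proof.
rewrite /affD_lex affD_lex_seq => le m0; move: le.
have -> : n.-1 = ((n - 2) + 1)%N by lia.
rewrite iotaD map_cat /= (_ : 2 + (n - 2) = n)%N; last lia.
rewrite -catA => /lex_le_cat0[|m'0].
  by move=> _ /mapP[j jk ->]; apply: m0; move: jk; rewrite mem_iota; lia.
rewrite /lex_le /= => /lexi_lehead le; split; last by rewrite -leEnat.
move=> k hk; apply: m'0; apply/mapP; exists k => //; rewrite mem_iota; lia.
Qed.

Lemma affD_leading_term (A : set {mpoly K[n]}) p k (m : 'X_{1..n}) :
  A p -> (2 <= k <= n)%N -> p@_m != 0 ->
  (forall m', p@_m' != 0 -> m' = m \/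
    (m' (vtx k) < m (vtx k))%N /\
      (forall j, (2 <= j < k)%N -> m' (vtx j) = m (vtx j))) ->
  leading_terms (@affD_lex n) A (p@_m *: 'X_[m]).
Proof.
move=> Ap hk pm lt; exists p, m; split; rewrite ?mcoeff_msupp // => m'.
rewrite mcoeff_msupp => /lt[->|[mk mj]]; last exact: (affD_lex_lt hk).
exact: Order.POrderTheory.lexx.
Qed.

End AffDLex.

(** * Equations, conic model and tangent spaces of one curve *)

Section AffDCurve.
Variables (K : numFieldType) (n : nat) (hn : (5 <= n)%N).
Variables a b c d e : nat -> K.
Hypotheses (a2 : a 2 = a 1) (b2 : b 2 = b 1).
Hypotheses (an1 : a (n - 1)%N = a n) (bn1 : b (n - 1)%N = b n).
Hypotheses (a1_neq0 : a 1 != 0) (b1_neq0 : b 1 != 0) (al_neq0 : alpha n a b != 0).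

Local Notation vtx := (vertex hn).
Local Notation al := (alpha n a b).
Local Notation basis := (affD_basis hn a b c d e).

(** End coordinates carry an extra factor t so that t^2 is the denominator throughout. *)
Definition affD_numerator (i : 'I_n) : {poly K} :=
  if i.+1 \in end_labels n then (a i.+1 *: 'X^2 + (b i.+1)%:P) * 'X
  else c i.+1 *: 'X^4 + d i.+1 *: 'X^2 + (e i.+1)%:P.

Local Notation G := affD_numerator.

Lemma curve_param t i : t != 0 -> curve G t i = param n a b c d e i.+1 t.
Proof.
by move=> t0; rewrite /curve /param /G; case: ifP => _; rewrite !hornerE //=; field.
Qed.

Lemma curve_end t v : t != 0 -> v \in end_labels n -> (0 < v <= n)%N ->
  curve G t (vtx v) = a v * t + b v * t^-1.
Proof.
by move=> t0 vend hv; rewrite curve_param // vertexE // /param vend; field.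
Qed.

Lemma curve_mid t v : t != 0 -> (3 <= v <= n - 2)%N ->
  curve G t (vtx v) = c v * t ^+ 2 + d v + e v * t^-1 ^+ 2.
Proof.
move=> t0 hv; rewrite curve_param // vertexE; last lia.
rewrite /param end_labelsE ifN; last lia.
by field.
Qed.

Lemma curve1 t : t != 0 -> curve G t (vtx 1) = a 1 * t + b 1 * t^-1.
Proof. by move=> t0; rewrite curve_end //; lia. Qed.

Lemma curve2 t : t != 0 -> curve G t (vtx 2) = a 1 * t + b 1 * t^-1.
Proof. by move=> t0; rewrite curve_end ?a2 ?b2 //; lia. Qed.

Lemma curve_n t : t != 0 -> curve G t (vtx n) = a n * t + b n * t^-1.
Proof. by move=> t0; rewrite curve_end // ?end_labelsE; lia. Qed.

Lemma curve_n1 t : t != 0 -> curve G t (vtx (n - 1)) = a n * t + b n * t^-1.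
Proof. by move=> t0; rewrite curve_end ?an1 ?bn1 // ?end_labelsE; lia. Qed.

Lemma affD_basisP (Pr : {mpoly K[n]} -> Prop) :
  Pr (Lfirst K hn) -> (forall k, (3 <= k <= n - 2)%N -> Pr (Lmid hn a b c d e k)) ->
  Pr (Llast K hn) -> Pr (Hpoly hn a b) -> forall g, g \in basis -> Pr g.
Proof.
move=> P2 Pk Pn PH g; rewrite inE mem_cat !inE.
move=> /or3P[/eqP-> //|/mapP[k kn ->]|/orP[]/eqP -> //].
by apply: Pk; move: kn; rewrite mem_iota; lia.
Qed.

Lemma Lfirst_basis : Lfirst K hn \in basis.
Proof. exact: mem_head. Qed.

Lemma Lmid_basis k : (3 <= k <= n - 2)%N -> Lmid hn a b c d e k \in basis.
Proof.
move=> hk; rewrite inE mem_cat map_f ?orbT // mem_iota; lia.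
Qed.

Lemma Llast_basis : Llast K hn \in basis.
Proof. by rewrite inE mem_cat !inE eqxx !orbT. Qed.

Lemma Hpoly_basis : Hpoly hn a b \in basis.
Proof. by rewrite inE mem_cat !inE eqxx !orbT. Qed.

Lemma meval_Lfirst (x : 'I_n -> K) : (Lfirst K hn).@[x] = x (vtx 2) - x (vtx 1).
Proof. by rewrite mevalB !mevalXU. Qed.

Lemma meval_Llast (x : 'I_n -> K) : (Llast K hn).@[x] = x (vtx (n - 1)) - x (vtx n).
Proof. by rewrite mevalB !mevalXU. Qed.

Lemma meval_Lmid (x : 'I_n -> K) k : (Lmid hn a b c d e k).@[x] =
  x (vtx k)
  + (a 1 * a n * e k - b 1 * b n * c k) / (a 1 * b 1 * al) * x (vtx 1) ^+ 2
  - (a 1 ^+ 2 * e k - b 1 ^+ 2 * c k) / (a 1 * b 1 * al) * (x (vtx 1) * x (vtx n))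
  + (a 1 ^+ 2 * e k - a 1 * b 1 * d k + b 1 ^+ 2 * c k) / (a 1 * b 1).
Proof. by rewrite /Lmid !(mevalD, mevalN, mevalZ, mevalC, mevalM, rmorphXn) /= !mevalXU. Qed.

Lemma meval_Hpoly (x : 'I_n -> K) : (Hpoly hn a b).@[x] =
  a n * b n * x (vtx 1) ^+ 2 - (a 1 * b n + a n * b 1) * (x (vtx 1) * x (vtx n))
  + a 1 * b 1 * x (vtx n) ^+ 2 + al ^+ 2.
Proof. by rewrite /Hpoly !(mevalD, mevalN, mevalZ, mevalC, mevalM, rmorphXn) /= !mevalXU. Qed.

Lemma basis_vanishes g : g \in basis -> vanishing_ideal (curve_image G) g.
Proof.
move: g; apply: affD_basisP => [|k hk||] _ [t t0 ->].
- by rewrite meval_Lfirst curve2 // curve1 // subrr.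
- rewrite meval_Lmid curve_mid // curve1 // curve_n //.
  by rewrite /alpha; field; rewrite t0 al_neq0 b1_neq0 a1_neq0.
- by rewrite meval_Llast curve_n1 // curve_n // subrr.
- rewrite meval_Hpoly curve1 // curve_n // /alpha; field.
  by [].
Qed.

(* The linear functions of (x_1, x_n) that take the values t and 1/t on the curve. *)
Definition coordP (x1 xn : K) : K := (b n * x1 - b 1 * xn) / al.
Definition coordQ (x1 xn : K) : K := (a 1 * xn - a n * x1) / al.

Lemma coordP_curve t : t != 0 ->
  coordP (curve G t (vtx 1)) (curve G t (vtx n)) = t.
Proof.
move=> t0; rewrite curve1 // curve_n // /coordP.
by move: al_neq0; rewrite /alpha => al0; field; rewrite ?al0 ?t0.
Qed.

Lemma coordQ_curve t : t != 0 ->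
  coordQ (curve G t (vtx 1)) (curve G t (vtx n)) = t^-1.
Proof.
move=> t0; rewrite curve1 // curve_n // /coordQ.
by move: al_neq0; rewrite /alpha => al0; field; rewrite ?al0 ?t0.
Qed.

Lemma coordPQ_ends x1 xn : x1 = a 1 * coordP x1 xn + b 1 * coordQ x1 xn /\
  xn = a n * coordP x1 xn + b n * coordQ x1 xn.
Proof.
by rewrite /coordP /coordQ; move: al_neq0; rewrite /alpha => al0; split; field.
Qed.

(** Turns the conic [Hpoly] into the hyperbola PQ = 1, so that P can serve as the parameter of a
    zero. *)
Lemma coordPQ_H x1 xn :
  a n * b n * x1 ^+ 2 - (a 1 * b n + a n * b 1) * (x1 * xn)
  + a 1 * b 1 * xn ^+ 2 + al ^+ 2 = al ^+ 2 * (1 - coordP x1 xn * coordQ x1 xn).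
Proof.
by rewrite /coordP /coordQ; move: al_neq0; rewrite /alpha => al0; field.
Qed.

Lemma curve_image_zero_locus : curve_image G = zero_locus [set` basis].
Proof.
apply/seteqP; split=> [x Cx g /basis_vanishes|x Zx]; first exact.
have /eqP := Zx _ Lfirst_basis; rewrite meval_Lfirst subr_eq0 => /eqP x2E.
have /eqP := Zx _ Llast_basis; rewrite meval_Llast subr_eq0 => /eqP xnE.
have /eqP := Zx _ Hpoly_basis; rewrite meval_Hpoly coordPQ_H mulf_eq0.
rewrite expf_eq0 (negPf al_neq0) /= subr_eq0 => /eqP PQ.
set p := coordP _ _ in PQ; set q := coordQ _ _ in PQ.
have p0 : p != 0.
  by apply: contra_eq_neq (esym PQ) => ->; rewrite mul0r eq_sym oner_neq0.
have qE : q = p^-1 by apply: (mulfI p0); rewrite -PQ divff.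
have [x1E xnE'] : x (vtx 1) = a 1 * p + b 1 * p^-1 /\ x (vtx n) = a n * p + b n * p^-1.
  by rewrite -qE; apply: coordPQ_ends.
exists p => //; apply: vertex_ext => k /(label_cases hn)[|hk].
  rewrite end_labelsE => /or4P[] /eqP ->.
  - by rewrite curve1.
  - by rewrite x2E curve2.
  - by rewrite xnE curve_n1.
  - by rewrite curve_n.
have /eqP := Zx _ (Lmid_basis hk); rewrite meval_Lmid -!addrA addr_eq0 => /eqP ->.
rewrite curve_mid // x1E xnE'; move: al_neq0; rewrite /alpha => al0.
by field; rewrite p0 al0 b1_neq0 a1_neq0.
Qed.

Lemma affD_curve_closed : zariski_closed (curve_image G).
Proof. by rewrite curve_image_zero_locus; exists [set` basis]. Qed.

Lemma affD_curve_conic :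
  exists Z : set ('I_2 -> K), plane_conic Z /\ isomorphic (curve_image G) Z.
Proof.
pose h : {mpoly K[2]} := 'X_0 * 'X_1 - 1.
exists (zero_locus [set h]); split.
  (* The two terms of [h] have disjoint supports, so the degree is read off from each separately. *)
  exists h; split=> //; rewrite msizeE (perm_big _ (msuppD _)) /=; last first.
    move=> m; rewrite /= -mpolyXD msuppX inE; case: eqP => //= ->.
    by rewrite mcoeff_msupp mcoeffN mcoeff1 mnmD_eq0 mnm1_eq0 oppr0 eqxx.
  rewrite -mpolyXD msuppX big_cons (perm_big _ (msuppN _)) -mpolyC1 msupp1 big_seq1 /=.
  by rewrite mdegD !mdeg1 mdeg0.
(* [f] reads off (t, 1/t), and [g] substitutes X_0 and X_1 for t and 1/t in the parametrization. *)
pose f (i : 'I_2) : {mpoly K[n]} := if i == 0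
  then (b n / al) *: 'X_(vtx 1) - (b 1 / al) *: 'X_(vtx n)
  else (a 1 / al) *: 'X_(vtx n) - (a n / al) *: 'X_(vtx 1).
pose g (i : 'I_n) : {mpoly K[2]} := if i.+1 \in end_labels n
  then a i.+1 *: 'X_0 + b i.+1 *: 'X_1
  else c i.+1 *: 'X_0 ^+ 2 + (d i.+1)%:MP + e i.+1 *: 'X_1 ^+ 2.
have fE x : poly_map f x =
    fun i => if i == 0 then coordP (x (vtx 1)) (x (vtx n)) else coordQ (x (vtx 1)) (x (vtx n)).
  apply/funext => i; rewrite /poly_map /f; case: eqP => _;
  by rewrite mevalB !mevalZ !mevalXU /coordP /coordQ; ring.
have gE z : z 0 != 0 -> z 1 = (z 0)^-1 -> poly_map g z = curve G (z 0).
  move=> z0 z1; apply/funext => i; rewrite curve_param // /poly_map /g /param.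
  case: ifP => _; rewrite !(mevalD, mevalZ, mevalC, rmorphXn) /= !mevalXU z1; by field.
have hE z : zero_locus [set h] z -> z 0 != 0 /\ z 1 = (z 0)^-1.
  move=> /(_ h erefl) /eqP; rewrite /h mevalB mevalM !mevalXU meval1 subr_eq0 => /eqP z01.
  have z0 : z 0 != 0.
    by apply: contra_eq_neq z01 => ->; rewrite mul0r eq_sym oner_neq0.
  by split=> //; apply: (mulfI z0); rewrite z01 divff.
exists f, g; split.
- move=> _ [t t0 ->] _ ->; rewrite /h mevalB mevalM !mevalXU meval1 fE /=.
  by rewrite coordP_curve // coordQ_curve // divff // subrr.
- by move=> z /hE[z0 z1]; rewrite gE //; exists (z 0).
- move=> _ [t t0 ->]; rewrite gE fE /= ?coordP_curve ?coordQ_curve //.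
- move=> z /hE[z0 z1]; rewrite gE // fE coordP_curve // coordQ_curve // -z1.
  by apply/funext => i; case: ifP => [/eqP -> //|i0]; congr z; apply/val_inj;
     case: i i0 => -[|[|]].
Qed.

Lemma directional_Lfirst (x v : 'I_n -> K) :
  directional x v (Lfirst K hn) = v (vtx 2) - v (vtx 1).
Proof. by rewrite directionalD directionalN !directionalX. Qed.

Lemma directional_Llast (x v : 'I_n -> K) :
  directional x v (Llast K hn) = v (vtx (n - 1)) - v (vtx n).
Proof. by rewrite directionalD directionalN !directionalX. Qed.

Lemma directional_Lmid (x v : 'I_n -> K) k :
  directional x v (Lmid hn a b c d e k) =
  v (vtx k)
  + (a 1 * a n * e k - b 1 * b n * c k) / (a 1 * b 1 * al) * (2 * x (vtx 1) * v (vtx 1))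
  - (a 1 ^+ 2 * e k - b 1 ^+ 2 * c k) / (a 1 * b 1 * al)
    * (v (vtx 1) * x (vtx n) + x (vtx 1) * v (vtx n)).
Proof.
rewrite /Lmid !(directionalD, directionalN, directionalZ, directionalC) expr2.
by rewrite !directionalM !directionalX !mevalXU addr0; ring.
Qed.

Lemma directional_Hpoly (x v : 'I_n -> K) :
  directional x v (Hpoly hn a b) =
  a n * b n * (2 * x (vtx 1) * v (vtx 1))
  - (a 1 * b n + a n * b 1) * (v (vtx 1) * x (vtx n) + x (vtx 1) * v (vtx n))
  + a 1 * b 1 * (2 * x (vtx n) * v (vtx n)).
Proof.
rewrite /Hpoly !(directionalD, directionalN, directionalZ, directionalC) !expr2.
by rewrite !directionalM !directionalX !mevalXU addr0; ring.
Qed.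

Lemma velocity_end t v : t != 0 -> v \in end_labels n -> (0 < v <= n)%N ->
  velocity G t (vtx v) = a v - b v / t ^+ 2.
Proof.
move=> t0 vend hv; rewrite /velocity /G vertexE // vend.
by rewrite !(derivE, hornerE) /=; field.
Qed.

Lemma velocity_mid t v : t != 0 -> (3 <= v <= n - 2)%N ->
  velocity G t (vtx v) = 2 * (c v * t - e v / t ^+ 3).
Proof.
move=> t0 hv; rewrite /velocity /G vertexE; last lia.
rewrite end_labelsE ifN; last lia.
by rewrite !(derivE, hornerE) /=; field.
Qed.

(** The differential of H is that of PQ = 1 up to a nonzero factor, so the (P, Q) part of [v] is a
    multiple of (1, -1/t^2). The differentials of the L's then determine the other components. *)
Lemma tangent_velocity t (v : 'I_n -> K) : t != 0 ->
  (forall g, g \in basis -> directional (curve G t) v g = 0) ->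
  exists r, forall i, v i = r * velocity G t i.
Proof.
move=> t0 vT.
have /eqP := vT _ Lfirst_basis; rewrite directional_Lfirst subr_eq0 => /eqP v2E.
have /eqP := vT _ Llast_basis; rewrite directional_Llast subr_eq0 => /eqP vnE.
have := vT _ Hpoly_basis; rewrite directional_Hpoly curve1 // curve_n // => vH.
have [v1E vnE'] := coordPQ_ends (v (vtx 1)) (v (vtx n)).
set p := coordP _ _ in v1E vnE'; set q := coordQ _ _ in v1E vnE'.
have qE : q = - (p / t ^+ 2).
  have : al ^+ 2 * (q * t + p / t) = 0.
    rewrite -[RHS]oppr0 -vH v1E vnE' /alpha; field.
    by [].
  move=> /eqP; rewrite mulf_eq0 expf_eq0 (negPf al_neq0) /= => /eqP qp.
  apply: (mulIf t0); apply/eqP; rewrite -subr_eq0 -qp; apply/eqP; field.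
  by [].
have {}v1E : v (vtx 1) = p * (a 1 - b 1 / t ^+ 2) by rewrite v1E qE; ring.
have {}vnE' : v (vtx n) = p * (a n - b n / t ^+ 2) by rewrite vnE' qE; ring.
exists p => i; suff -> : v = fun i => p * velocity G t i by [].
apply: vertex_ext => k hk; have [kend|kmid] := label_cases hn hk.
  rewrite velocity_end //; move: kend; rewrite end_labelsE => /or4P[] /eqP ->.
  - by [].
  - by rewrite v2E a2 b2.
  - by rewrite vnE an1 bn1.
  - by [].
have /eqP := vT _ (Lmid_basis kmid).
rewrite directional_Lmid -addrA addr_eq0 => /eqP ->.
rewrite velocity_mid // curve1 // curve_n // v1E vnE'.
move: al_neq0; rewrite /alpha => al0.
by field; rewrite t0 al0 b1_neq0 a1_neq0.
Qed.

(** If components 1 and n both vanish, then a_i = b_i / t^2 for i = 1, n, and alpha would be 0. *)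
Lemma velocity_neq0 t : t != 0 -> exists i, velocity G t i != 0.
Proof.
move=> t0; apply: contrapT => /forallNP v0.
have v1 := v0 (vtx 1); have vn := v0 (vtx n).
case/eqP: al_neq0; move: v1 vn => /negP; rewrite negbK => /eqP v1 /negP.
rewrite negbK => /eqP.
rewrite velocity_end ?end_labelsE; [|by []|lia..] => vn.
move: v1; rewrite velocity_end ?end_labelsE; [|by []|lia..] => v1.
have a1E : a 1 = b 1 / t ^+ 2 by apply/eqP; rewrite -subr_eq0 v1.
have anE : a n = b n / t ^+ 2 by apply/eqP; rewrite -subr_eq0 vn.
by rewrite /alpha a1E anE; ring.
Qed.

Lemma affD_curve_smooth : smooth (curve_image G).
Proof.
exists 1%N; split.
  (* The points at t = 1 and t = -1 differ because [coordP] recovers t. *)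
  apply: (@curve_dimension _ _ G affD_curve_closed (curve G 1) (curve G (-1))).
  - by exists 1; rewrite ?oner_neq0.
  - by exists (-1); rewrite ?oppr_eq0 ?oner_neq0.
  - have := @coordP_curve 1 (oner_neq0 _) => P1 E; move: P1; rewrite E.
    rewrite coordP_curve ?oppr_eq0 ?oner_neq0 // => /eqP.
    by rewrite eqNr oner_eq0.
move=> _ [t t0 ->]; pose w : 'rV[K]_n := \row_i velocity G t i.
exists <[w]>%VS; split.
  rewrite dim_vline; case: eqP => // w0.
  have [i /eqP[]] := velocity_neq0 t0.
  by have /rowP/(_ i) := w0; rewrite !mxE.
move=> v; split.
  move=> /vlineP[r ->] f fC.
  transitivity (r * directional (curve G t) (velocity G t) f).
    rewrite /directional mulr_sumr; apply: eq_bigr => i _; rewrite !mxE; ring.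
  by rewrite curve_velocity_tangent // mulr0.
move=> vT; have [g gb|r vE] := @tangent_velocity t (v 0) t0.
  exact/vT/basis_vanishes.
apply/vlineP; exists r; apply/rowP => i; rewrite !mxE; exact: vE.
Qed.

(** * Leading terms and the Gröbner basis *)

Lemma mnm1_vertex k j : (0 < k <= n)%N -> (0 < j <= n)%N ->
  (U_(vtx k)%MM : 'X_{1..n}) (vtx j) = (k == j) :> nat.
Proof. by move=> hk hj; rewrite mnm1E vertex_inj. Qed.

Lemma mnm_neq (m m' : 'X_{1..n}) i : m i != m' i -> (m == m') = false.
Proof. by move=> neq; apply: contraNF neq => /eqP ->. Qed.

(** Covers both L_2 and L_(n-1); l = 1 is allowed because x_1 is the smallest variable. *)
Lemma lead_diff k l : (2 <= k < n)%N -> (k < l <= n)%N || (l == 1) ->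
  'X_(vtx k) - 'X_(vtx l) \in basis ->
  leading_terms (@affD_lex n) [set` basis] 'X_(vtx k).
Proof.
move=> hk hl pG; set p := _ - _ in pG.
have pE m' : p@_m' = (U_(vtx k)%MM == m')%:R - (U_(vtx l)%MM == m')%:R.
  by rewrite mcoeffB !mcoeffX.
have pk : p@_U_(vtx k) = 1.
  rewrite pE eqxx (@mnm_neq _ _ (vtx k)) ?subr0 //.
  by rewrite !mnm1_vertex; lia.
rewrite -['X_(vtx k)]scale1r -pk.
apply: (@affD_leading_term _ _ hn _ _ k) => //; [lia|by rewrite pk oner_neq0|].
move=> m'; rewrite pE; case: (U_(vtx k)%MM =P m') => [<-|_]; first by left.
case: (U_(vtx l)%MM =P m') => [<- _|_]; last by rewrite subrr eqxx.
by right; split=> [|j hj]; rewrite !mnm1_vertex; lia.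
Qed.

Lemma lead_mid k : (3 <= k <= n - 2)%N ->
  leading_terms (@affD_lex n) [set` basis] 'X_(vtx k).
Proof.
move=> hk; have pG := Lmid_basis hk; set p := Lmid _ _ _ _ _ _ k in pG.
have pE m' : p@_m' = (U_(vtx k)%MM == m')%:R +
    (a 1 * a n * e k - b 1 * b n * c k) / (a 1 * b 1 * al) *
      ((U_(vtx 1) *+ 2)%MM == m')%:R -
    (a 1 ^+ 2 * e k - b 1 ^+ 2 * c k) / (a 1 * b 1 * al) *
      ((U_(vtx 1) + U_(vtx n))%MM == m')%:R +
    (a 1 ^+ 2 * e k - a 1 * b 1 * d k + b 1 ^+ 2 * c k) / (a 1 * b 1) *
      (m' == 0%MM)%:R.
  by rewrite /p /Lmid -mpolyXD mpolyXn !(mcoeffD, mcoeffN, mcoeffZ, mcoeffC, mcoeffX).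
have pk : p@_U_(vtx k) = 1.
  rewrite pE eqxx !(@mnm_neq _ _ (vtx k)) ?mulr0 ?subr0 ?addr0 //;
    rewrite ?mulmnE ?mnmDE ?mnm0E !mnm1_vertex; lia.
rewrite -['X_(vtx k)]scale1r -pk.
apply: (@affD_leading_term _ _ hn _ _ k) => //; [lia|by rewrite pk oner_neq0|].
move=> m'; rewrite pE; case: (U_(vtx k)%MM =P m') => [<-|_]; first by left.
move=> h; right; move: h.
case: ((U_(vtx 1) *+ 2)%MM =P m') => [<- _|_].
  by split=> [|j hj]; rewrite !mulmnE !mnm1_vertex; lia.
case: ((U_(vtx 1) + U_(vtx n))%MM =P m') => [<- _|_].
  by split=> [|j hj]; rewrite !mnmDE !mnm1_vertex; lia.
case: (m' =P 0%MM) => [-> _|_]; last by rewrite !mulr0 subr0 !addr0 eqxx.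
by split=> [|j hj]; rewrite !mnm0E !mnm1_vertex; lia.
Qed.

(** The other monomials of H have degree at most 1 in x_n, and x_n > x_1. *)
Lemma lead_conic :
  leading_terms (@affD_lex n) [set` basis] ((a 1 * b 1) *: 'X_[U_(vtx n) *+ 2]).
Proof.
have pG := Hpoly_basis; set p := Hpoly _ _ _ in pG.
have pE m' : p@_m' = a n * b n * ((U_(vtx 1) *+ 2)%MM == m')%:R -
    (a 1 * b n + a n * b 1) * ((U_(vtx 1) + U_(vtx n))%MM == m')%:R +
    a 1 * b 1 * ((U_(vtx n) *+ 2)%MM == m')%:R + al ^+ 2 * (m' == 0%MM)%:R.
  by rewrite /p /Hpoly -mpolyXD !mpolyXn !(mcoeffD, mcoeffN, mcoeffZ, mcoeffC, mcoeffX).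
have pk : p@_(U_(vtx n) *+ 2) = a 1 * b 1.
  rewrite pE eqxx !(@mnm_neq _ _ (vtx n)) ?mulr0 ?mulr1 ?subr0 ?addr0 ?add0r //;
    rewrite ?mulmnE ?mnmDE ?mnm0E ?mulmnE !mnm1_vertex; lia.
rewrite -pk.
apply: (@affD_leading_term _ _ hn _ _ n) => //; [lia|by rewrite pk mulf_neq0|].
move=> m'; rewrite pE; have [<-|_] := eqVneq (U_(vtx n) *+ 2)%MM m'; first by left.
move=> h; right; move: h.
case: ((U_(vtx 1) *+ 2)%MM =P m') => [<- _|_].
  by split=> [|j hj]; rewrite !mulmnE !mnm1_vertex; lia.
case: ((U_(vtx 1) + U_(vtx n))%MM =P m') => [<- _|_].
  by split=> [|j hj]; rewrite !mulmnE !mnmDE !mnm1_vertex; lia.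
case: (m' =P 0%MM) => [-> _|_]; last by rewrite !mulr0 subr0 !addr0 eqxx.
by split=> [|j hj]; rewrite !mulmnE !mnm0E !mnm1_vertex; lia.
Qed.

Lemma lead_var k : (2 <= k < n)%N ->
  leading_terms (@affD_lex n) [set` basis] 'X_(vtx k).
Proof.
move=> hk; have [k2|k2] := eqVneq k 2.
  by rewrite k2; apply: lead_diff Lfirst_basis => //; lia.
have [kn|kn] := eqVneq k (n - 1)%N.
  by rewrite kn; apply: lead_diff Llast_basis => //; lia.
by apply: lead_mid; lia.
Qed.

(* For each t the point w = a 1 t + b 1 / t is the root of a quadratic, so a root of F
   at all those w makes t a root of a fixed nonzero polynomial. *)
Lemma poly_zero_on_first_coordinate (F : {poly K}) :
  (forall t : K, t != 0 -> a 1 * t ^+ 2 != b 1 -> F.[a 1 * t + b 1 * t^-1] = 0) -> F = 0.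
Proof.
move=> FE; apply/eqP; apply: contraT => /poly_finite_roots[s Fs].
pose quad r : {poly K} := a 1 *: 'X^2 - r *: 'X + (b 1)%:P.
have quad_neq0 r : quad r != 0.
  apply: contraNneq a1_neq0 => /(congr1 (fun q : {poly K} => q`_2)).
  by rewrite !(coefD, coefN, coefZ, coefXn, coefX, coefC, coef0) /= mulr1 mulr0 subr0 addr0 => ->.
(* This factor takes care of the excluded parameters, the fixed points of t -> b_1 / (a_1 t). *)
pose conj : {poly K} := a 1 *: 'X^2 - (b 1)%:P.
have conj_neq0 : conj != 0.
  apply: contraNneq a1_neq0 => /(congr1 (fun q : {poly K} => q`_2)).
  by rewrite !(coefD, coefN, coefZ, coefXn, coefC, coef0) /= mulr1 subr0 => ->.
have prod_neq0 : (\prod_(r <- s) quad r) * conj != 0.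
  rewrite mulf_neq0 // prodf_seq_neq0; apply/allP => r _; exact: quad_neq0.
case/eqP: prod_neq0; apply: (@poly_injective_roots _ _ (fun m => m.+1%:R)) => [i j /eqP|m].
  by rewrite eqr_nat eqSS => /eqP.
have t0 : m.+1%:R != 0 :> K by rewrite pnatr_eq0.
move: (m.+1%:R : K) t0 => t t0; rewrite hornerM.
have [tb|/(FE t t0)/rootP/Fs rs] := eqVneq (a 1 * t ^+ 2) (b 1).
  have -> : conj.[t] = a 1 * t ^+ 2 - b 1 by rewrite /conj !(hornerD, hornerN, hornerZ, hornerX, hornerXn, hornerC).
  by rewrite tb subrr mulr0.
rewrite (big_rem _ rs) /= hornerM.
rewrite (_ : (quad (a 1 * t + b 1 * t^-1)).[t] = 0) ?mul0r ?mul0r //.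
by rewrite /quad !(hornerD, hornerN, hornerZ, hornerX, hornerXn, hornerC); field.
Qed.

(** The order confines the monomials of [f] to x_1 and x_n, with degree at most 1 in x_n. So f =
    F_0(x_1) + x_n F_1(x_1), and the symmetry of the parameter forces F_1 = F_0 = 0. *)
Lemma reduced_leading_coef (f : {mpoly K[n]}) (m : 'X_{1..n}) :
  vanishing_ideal (curve_image G) f ->
  (forall m', m' \in msupp f -> affD_lex m' m) ->
  (forall k, (2 <= k < n)%N -> m (vtx k) = 0%N) -> (m (vtx n) <= 1)%N ->
  m \in msupp f -> False.
Proof.
move=> fC lead mk mn mf.
have supp m' : m' \in msupp f ->
    (forall k, (2 <= k < n)%N -> m' (vtx k) = 0%N) /\ (m' (vtx n) <= m (vtx n))%N.
  by move=> /lead le; apply: affD_lex_le0 le mk.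
pose F (s : nat) : {poly K} :=
  \sum_(m' <- msupp f | m' (vtx n) == s) f@_m' *: 'X^(m' (vtx 1)).
have v1n : vtx 1 != vtx n by rewrite vertex_inj; lia.
have fE (x : 'I_n -> K) :
    f.@[x] = (F 0%N).[x (vtx 1)] + x (vtx n) * (F 1%N).[x (vtx 1)].
  rewrite mevalE /F !horner_sum mulr_sumr.
  rewrite (bigID (fun m' : 'X_{1..n} => m' (vtx n) == 0%N)) /=.
  have term m' : m' \in msupp f ->
      \prod_i x i ^+ m' i = x (vtx 1) ^+ m' (vtx 1) * x (vtx n) ^+ m' (vtx n).
    move=> /supp[m'0 _]; rewrite (bigD1 (vtx 1)) //= (bigD1 (vtx n)) /=; last first.
      by rewrite eq_sym.
    rewrite [X in _ * (_ * X)]big1 ?mulr1 // => i /andP[i1 iN].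
    rewrite -(vertexK hn i) m'0 ?expr0 //.
    move: i1 iN; rewrite !eq_vertex; [|lia..].
    by have := ltn_ord i; lia.
  have low : \sum_(m' <- msupp f | m' (vtx n) == 0%N) f@_m' * (\prod_i x i ^+ m' i) =
      \sum_(m' <- msupp f | m' (vtx n) == 0%N) (f@_m' *: 'X^(m' (vtx 1))).[x (vtx 1)].
    rewrite big_seq_cond [RHS]big_seq_cond; apply: eq_bigr => m' /andP[m'f /eqP m'n].
    by rewrite term // m'n expr0 mulr1 hornerZ hornerXn.
  have high : \sum_(m' <- msupp f | m' (vtx n) != 0%N) f@_m' * (\prod_i x i ^+ m' i) =
      \sum_(m' <- msupp f | m' (vtx n) == 1%N)
        x (vtx n) * (f@_m' *: 'X^(m' (vtx 1))).[x (vtx 1)].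
    rewrite big_seq_cond [RHS]big_seq_cond; apply: eq_big => [m'|m' /andP[m'f m'n]].
      case m'f: (m' \in msupp f) => //=; have [_ le] := supp _ m'f.
      by move: le mn; lia.
    have m'1 : m' (vtx n) = 1%N by have [_ le] := supp _ m'f; move: le mn m'n; lia.
    by rewrite term // m'1 expr1 hornerZ hornerXn; ring.
  by rewrite low high.
have FC (t : K) : t != 0 ->
    (F 0%N).[a 1 * t + b 1 * t^-1] + (a n * t + b n * t^-1) * (F 1%N).[a 1 * t + b 1 * t^-1] = 0.
  by move=> t0; rewrite -curve1 // -curve_n // -fE; apply: fC; exists t.
(* The substitution t -> b 1 / (a 1 t) fixes the first coordinate and moves the last one. *)
have F1 : F 1%N = 0.
  apply: poly_zero_on_first_coordinate => t t0 tb.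
  pose t' := b 1 / (a 1 * t).
  have t'0 : t' != 0 by rewrite mulf_neq0 ?invr_eq0 ?mulf_neq0.
  have x1E : a 1 * t' + b 1 * t'^-1 = a 1 * t + b 1 * t^-1.
    by rewrite /t'; field; rewrite t0 b1_neq0 a1_neq0.
  have := FC t' t'0; rewrite x1E => E'.
  have : (a n * t + b n * t^-1 - (a n * t' + b n * t'^-1)) * (F 1%N).[a 1 * t + b 1 * t^-1] = 0.
    by rewrite -[RHS](subrr 0) -{1}(FC t t0) -E'; ring.
  have -> : a n * t + b n * t^-1 - (a n * t' + b n * t'^-1) =
      - (al * (a 1 * t ^+ 2 - b 1) / (a 1 * b 1 * t)).
    by rewrite /t' /alpha; field; rewrite t0 b1_neq0 a1_neq0.
  move=> /eqP; rewrite mulf_eq0 oppr_eq0 !mulf_eq0 invr_eq0 !mulf_eq0.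
  by rewrite (negPf al_neq0) subr_eq0 (negPf tb) (negPf a1_neq0) (negPf b1_neq0) (negPf t0) => /eqP.
have F0 : F 0%N = 0.
  apply: poly_zero_on_first_coordinate => t t0 _.
  by have := FC t t0; rewrite F1 horner0 mulr0 addr0.
have Fs : F (m (vtx n)) = 0 by case: (m (vtx n)) mn => [|[|]].
(* A monomial of [f] is determined by its exponents at x_1 and x_n, so only [m] contributes to this
   coefficient. *)
have := congr1 (fun q : {poly K} => q`_(m (vtx 1))) Fs; rewrite coef0 /F coef_sum.
rewrite big_mkcond (bigD1_seq m) ?msupp_uniq //= eqxx coefZ coefXn eqxx mulr1.
rewrite big_seq_cond big1 ?addr0; first by apply/eqP; rewrite -mcoeff_msupp.
move=> m' /andP[m'f m'm]; case: eqP => // m'n.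
rewrite coefZ coefXn; case: eqP => [m1|_]; last by rewrite mulr0.
case/eqP: m'm; apply/mnmP => i; rewrite -(vertexK hn i).
have [m'0 _] := supp _ m'f.
have [i1|i1] := eqVneq i.+1 1%N; first by rewrite i1.
have [iN|iN] := eqVneq i.+1 n; first by rewrite iN.
by rewrite m'0 ?mk //; have := ltn_ord i; lia.
Qed.

(** A leading monomial of the ideal is divisible by some x_k with 2 <= k < n or by x_n^2, since
    [reduced_leading_coef] excludes all others. *)
Lemma affD_groebner_basis :
  groebner_basis (@affD_lex n) (vanishing_ideal (curve_image G)) basis.
Proof.
split; first exact: basis_vanishes.
apply/seteqP; split; apply: generated_ideal_sub => q.
  move=> [p [m [pG mp lead ->]]].
  rewrite -[X in generated_ideal _ X]mul1r; apply: generated_ideal_mul.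
  by exists p, m; split=> //; apply: basis_vanishes.
move=> [f [m [fC mf lead ->]]].
have [[k hk mk]|nk] := EM (exists2 k, (2 <= k < n)%N & m (vtx k) != 0%N).
  have -> : f@_m *: 'X_[m] = (f@_m *: 'X_[m - U_(vtx k)]) * 'X_(vtx k) :> {mpoly K[n]}.
    by rewrite -scalerAl -mpolyXD submK // lep1mP.
  exact/generated_ideal_mul/lead_var.
have [mn|mn] := leqP (m (vtx n)) 1.
  case: (reduced_leading_coef fC lead _ mn mf) => k hk; apply/eqP.
  by apply: contraT => mk; case: nk; exists k.
have -> : f@_m *: 'X_[m] = (f@_m / (a 1 * b 1)) *: 'X_[m - U_(vtx n) *+ 2] *
    ((a 1 * b 1) *: 'X_[U_(vtx n) *+ 2]) :> {mpoly K[n]}.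
  rewrite -scalerAl -scalerAr scalerA divfK ?mulf_neq0 // -mpolyXD submK //.
  apply/mnm_lepP => i; rewrite mulmnE mnm1E.
  by case: (vtx n =P i) => [<-|_]; rewrite ?mul1n.
exact/generated_ideal_mul/lead_conic.
Qed.

End AffDCurve.

(** * The components of the frieze variety *)

(** Take the larger root of X^2 - (q + 2) X + 1; the discriminant is q (q + 4) > 0. *)
Lemma exists_growth_rate (K : numClosedFieldType) (q : K) : 0 < q ->
  exists2 mu : K, 1 < mu & mu ^+ 2 = (q + 2) * mu - 1.
Proof.
move=> q0; have sqrtE := sqrtCK ((q + 2) ^+ 2 - 4).
exists ((q + 2 + sqrtC ((q + 2) ^+ 2 - 4)) / 2).
  rewrite ltr_pdivlMr ?ltr0n // mul1r addrAC ltrDr addr_gt0 //.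
  rewrite sqrtC_gt0 (_ : _ - 4 = q * (q + 4)); last by ring.
  by rewrite mulr_gt0 // addr_gt0.
move: (sqrtC _) sqrtE => r rE.
transitivity ((r ^+ 2 + 2 * (q + 2) * r + (q + 2) ^+ 2) / 4); first by field.
by rewrite rE; field.
Qed.

(** * Laurent form of the solution and its residue classes *)

Section FriezeCurve.
Variables (K : numFieldType) (n : nat) (hn : (5 <= n)%N) (mu : K).
Local Notation p := (n - 3)%N.
Local Notation P := (p%:R : K).
Hypotheses (mu_gt1 : 1 < mu) (mu_quadratic : mu ^+ 2 = (P + 2) * mu - 1).

Let P_neq0 : P != 0.
Proof. by rewrite pnatr_eq0; lia. Qed.

Let mu_gt0 : 0 < mu := lt_trans ltr01 mu_gt1.

Let mu_neq0 : mu != 0.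
Proof. by rewrite gt_eqF // (lt_trans ltr01 mu_gt1). Qed.

Let P_mu : P = mu + mu^-1 - 2.
Proof.
apply: (mulIf mu_neq0); rewrite mulrBl mulrDl mulVf // -expr2 mu_quadratic; ring.
Qed.

(* Along one residue class of t modulo p the curve parameter is z = mu^(2 m). *)
Definition slopeA (s : K) : K := 1 + s * (mu ^+ 2 - 1) / P.
Definition slopeB (s : K) : K := 1 + s * (mu ^- 2 - 1) / P.

(** [segment] is linear in its two values, and (P + 2) mu - 2 = mu^2 - 1, likewise with 1/mu for
    mu. *)
Lemma segment_laurent A B z s : z != 0 ->
  segment p (A * z + B * z^-1) (A * mu * z + B * mu^-1 * z^-1) s =
  A * slopeA s * z + B * slopeB s * z^-1.
Proof.
move=> z0; rewrite /segment /slopeA /slopeB.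
have -> : P + 2 = mu + mu^-1 by rewrite P_mu subrK.
by field; rewrite P_neq0 z0 mu_neq0.
Qed.

Lemma next_laurent A B z :
  next p (A * z + B * z^-1) (A * mu * z + B * mu^-1 * z^-1) =
  A * mu * mu * z + B * mu^-1 * mu^-1 * z^-1.
Proof.
rewrite /next (_ : P + 2 = mu + mu^-1); last by rewrite P_mu subrK.
transitivity (A * mu * mu * z + B * mu^-1 * mu^-1 * z^-1 +
  (A * z + B * z^-1) * (mu * mu^-1 - 1)); first by ring.
by rewrite divff // subrr mulr0 addr0.
Qed.

(** The branch depends on j and s alone; in each one [arc] is a product of two forms A' z + B' / z
    minus a constant. *)
Lemma arc_laurent A B j s : exists c d e : K, forall z : K, z != 0 ->
  arc p (A * z + B * z^-1) (A * mu * z + B * mu^-1 * z^-1) j s =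
  c * z ^+ 2 + d + e * z^-1 ^+ 2.
Proof.
have [sj|sj] := leqP (s + j) p.
  exists (A * slopeA (s%:R + j%:R) * (A * slopeA s%:R)).
  exists (A * slopeA (s%:R + j%:R) * (B * slopeB s%:R) +
    B * slopeB (s%:R + j%:R) * (A * slopeA s%:R) - j%:R).
  exists (B * slopeB (s%:R + j%:R) * (B * slopeB s%:R)) => z z0.
  rewrite /arc sj !segment_laurent //.
  by move: (slopeA _) (slopeB _) (slopeA _) (slopeB _) => *; field.
pose u : K := s%:R + j%:R - P.
exists (A * mu * mu * slopeA u * (A * slopeA s%:R)).
exists (A * mu * mu * slopeA u * (B * slopeB s%:R) +
  B * mu^-1 * mu^-1 * slopeB u * (A * slopeA s%:R)
  - (j%:R + (P + 4) * (P - s%:R) * u)).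
exists (B * mu^-1 * mu^-1 * slopeB u * (B * slopeB s%:R)) => z z0.
rewrite arc_ge //; last exact: ltnW.
rewrite !next_laurent !segment_laurent // -/u.
by move: (slopeA _) (slopeB _) (slopeA _) (slopeB _) => *; field; rewrite z0 mu_neq0.
Qed.

(** mu and 1/mu are the characteristic roots of the recurrence; the coefficients solve A + B = 1 and
    A mu + B / mu = 1. *)
Lemma V_laurent k : V K p k = (mu + 1)^-1 * mu ^+ k + mu / (mu + 1) * mu ^- k.
Proof.
have mu1 : mu + 1 != 0 by rewrite gt_eqF // addr_gt0 // (lt_trans ltr01 mu_gt1).
suff [] : V K p k = (mu + 1)^-1 * mu ^+ k + mu / (mu + 1) * mu ^- k /\
  V K p k.+1 = (mu + 1)^-1 * mu ^+ k.+1 + mu / (mu + 1) * mu ^- k.+1 by [].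
elim: k => [|k [IH1 IH2]].
  by split; rewrite /V /=; field; rewrite ?mu1 ?mu_neq0.
split=> //; rewrite VSS IH1 IH2.
have muk : mu ^+ k != 0 by rewrite expf_neq0.
have := next_laurent (mu + 1)^-1 (mu / (mu + 1)) (mu ^+ k).
rewrite !exprSr !invfM => E.
transitivity (next p ((mu + 1)^-1 * mu ^+ k + mu / (mu + 1) / mu ^+ k)
  ((mu + 1)^-1 * mu * mu ^+ k + mu / (mu + 1) / mu / mu ^+ k)).
  by congr next; ring.
by rewrite E; ring.
Qed.

Lemma slopeA_gt0 s : 0 < slopeA s%:R.
Proof.
apply: ltr_pwDl => //; rewrite divr_ge0 ?ler0n // mulr_ge0 ?ler0n //.
by rewrite subr_ge0 exprn_ege1 // ltW // mu_gt1.
Qed.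

(** For s < p this is a convex combination of 1 and mu^(-2) with positive weight on 1. *)
Lemma slopeB_gt0 s : (s < p)%N -> 0 < slopeB s%:R.
Proof.
move=> sp; have -> : slopeB s%:R = (P - s%:R + s%:R * mu ^- 2) / P.
  by rewrite /slopeB; field; rewrite P_neq0 mu_neq0.
rewrite divr_gt0 ?ltr0n //; last lia.
apply: ltr_pwDl; first by rewrite subr_gt0 ltr_nat.
by rewrite mulr_ge0 // invr_ge0 exprn_ge0 // ltW // (lt_trans ltr01 mu_gt1).
Qed.

Definition frieze_point (t : nat) : 'I_n -> K := fun i => ratr (frieze (@affD n) t i).

Lemma frieze_pointE t v : frieze_point t (vertex hn v) = ratr (affD_frieze hn t v).
Proof. by []. Qed.

Definition affD_curve (Z : set ('I_n -> K)) : Prop :=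
  exists a b c d e : nat -> K,
    [/\ [/\ a 2 = a 1, b 2 = b 1, a (n - 1)%N = a n & b (n - 1)%N = b n],
        (forall i, i \in end_labels n -> a i != 0 /\ b i != 0),
        alpha n a b != 0 &
        Z = curve_image (affD_numerator a b c d e)].

(** The times m p + s have parameters mu^(2m), infinitely many, so a polynomial vanishing at these
    points vanishes on the whole curve. *)
Lemma affD_curve_residue s : (s < p)%N -> exists Z : set ('I_n -> K),
  [/\ affD_curve Z, forall m, Z (frieze_point (m * p + s)) &
      forall W, zariski_closed W -> (forall m, W (frieze_point (m * p + s))) -> Z `<=` W].
Proof.
move=> sp.
pose A : K := (mu + 1)^-1; pose B : K := mu / (mu + 1).
have A0 : A != 0 by rewrite invr_eq0 gt_eqF // addr_gt0.
have B0 : B != 0 by rewrite mulf_neq0.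
have sA : slopeA s%:R != 0 by rewrite gt_eqF // slopeA_gt0.
have sB : slopeB s%:R != 0 by rewrite gt_eqF // slopeB_gt0.
(* The last coordinates come from the segment starting at y, whose coefficients are those of x times
   mu and 1/mu. *)
pose a v : K := if (v <= 2)%N then A * slopeA s%:R else A * mu * slopeA s%:R.
pose b v : K := if (v <= 2)%N then B * slopeB s%:R else B * mu^-1 * slopeB s%:R.
have /choice[cde cdeP] : forall v, exists u : K * K * K, forall z : K, z != 0 ->
    arc p (A * z + B * z^-1) (A * mu * z + B * mu^-1 * z^-1) (v - 2) s =
    u.1.1 * z ^+ 2 + u.1.2 + u.2 * z^-1 ^+ 2.
  by move=> v; have [c [d [e E]]] := arc_laurent A B (v - 2) s; exists (c, d, e).
pose c v := (cde v).1.1; pose d v := (cde v).1.2; pose e v := (cde v).2.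
have n2 : (n <= 2)%N = false by lia.
have n12 : (n - 1 <= 2)%N = false by lia.
have z0 m : (mu ^+ 2) ^+ m != 0 by rewrite !expf_neq0.
have pointE m : frieze_point (m * p + s) =
    curve (affD_numerator a b c d e) ((mu ^+ 2) ^+ m).
  apply: (@vertex_ext _ _ hn) => v hv; rewrite frieze_pointE ratr_affD_frieze //.
  rewrite curve_param // vertexE // /param.
  have -> : V K p m.*2 = A * (mu ^+ 2) ^+ m + B * ((mu ^+ 2) ^+ m)^-1.
    by rewrite V_laurent -exprM mul2n.
  have -> : V K p m.*2.+1 = A * mu * (mu ^+ 2) ^+ m + B * mu^-1 * ((mu ^+ 2) ^+ m)^-1.
    by rewrite V_laurent -exprM mul2n (exprSr mu) (invfM (mu ^+ m.*2)) -/A -/B; ring.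
  move: ((mu ^+ 2) ^+ m) (z0 m) => z {}z0.
  have [vend|hmid] := label_cases hn hv; last first.
    rewrite affD_solution_mid // cdeP // end_labelsE ifN; last lia.
    by rewrite /c /d /e; field.
  rewrite vend; have [v2|v2] := leqP v 2.
    by rewrite affD_solution_left // segment_laurent // /a /b v2; field.
  rewrite affD_solution_right //; last by move: vend; rewrite end_labelsE; lia.
  rewrite next_laurent segment_laurent // /a /b leqNgt v2 /=.
  by field; rewrite z0 mu_neq0.
exists (curve_image (affD_numerator a b c d e)); split.
- exists a, b, c, d, e; split=> //.
  + by rewrite /a /b n2 n12.
  + have muV : mu^-1 != 0 by rewrite invr_eq0.
    move=> i _; rewrite /a /b; case: ifP => _; split.
    * exact: mulf_neq0 A0 sA.
    * exact: mulf_neq0 B0 sB.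
    * exact: mulf_neq0 (mulf_neq0 A0 mu_neq0) sA.
    * exact: mulf_neq0 (mulf_neq0 B0 muV) sB.
  + rewrite /alpha /a /b n2 /=.
    (* This is alpha; it is nonzero because 1/mu < 1 < mu. *)
    have -> : A * slopeA s%:R * (B * mu^-1 * slopeB s%:R) -
        A * mu * slopeA s%:R * (B * slopeB s%:R) =
        A * B * slopeA s%:R * slopeB s%:R * (mu^-1 - mu) by ring.
    apply: mulf_neq0; first exact: mulf_neq0 (mulf_neq0 (mulf_neq0 A0 B0) sA) sB.
    rewrite subr_eq0 lt_eqF //.
    by rewrite (lt_trans _ mu_gt1) // invf_lt1 // mu_gt1.
- by move=> m; rewrite pointE; exists ((mu ^+ 2) ^+ m).
- move=> W cW Wpt x Cx; apply: contrapT => /(zariski_closed_separate cW)[f fW /eqP[]].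
  apply: (curve_dense (G := affD_numerator a b c d e) (z := fun m => (mu ^+ 2) ^+ m)) Cx => //.
    by apply: ieexprIn; rewrite ?exprn_gt0 // gt_eqF // exprn_egt1.
  by move=> m; rewrite -pointE; apply: fW.
Qed.

(** The p residue curves cover the frieze points, hence X, so Y lies in one of them. That curve lies
    in X, since every closed set through the frieze points contains it, and maximality of Y gives
    equality. *)
Lemma frieze_variety_component Y :
  irreducible_component (@frieze_variety n (@affD n) K) Y -> affD_curve Y.
Proof.
move=> [irrY YX maxY].
have p_gt0 : (0 < p)%N by lia.
(* Reducing s modulo p extends the family to all natural indices. *)
have /choice[Z ZP] : forall s, exists Z : set ('I_n -> K),
  [/\ affD_curve Z, forall m, Z (frieze_point (m * p + s %% p)) &
      forall W, zariski_closed W -> (forall m, W (frieze_point (m * p + s %% p))) -> Z `<=` W].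
  by move=> s; apply: affD_curve_residue; rewrite ltn_mod.
have irrZ s : irreducible (Z s).
  have [[a [b [c [d [e [[a2 b2 an bn] ab0 al0 ->]]]]]] _ _] := ZP s.
  have [a0 b0] := ab0 1%N (mem_head _ _).
  exact/curve_irreducible/(affD_curve_closed hn).
have cZ s : zariski_closed (Z s) by have [] := irrZ s.
have [|s sp YZ] := @irreducible_sub_bigU _ _ Y Z p irrY cZ.
  move=> x /YX; apply; split; first exact: zariski_closed_bigU.
  move=> _ [t _ <-]; exists (t %% p)%N; first by rewrite ltn_mod.
  by have [_ + _] := ZP (t %% p)%N; move=> /(_ (t %/ p)%N); rewrite modn_mod -divn_eq.
have [cvZ _ Zmin] := ZP s.
rewrite -(maxY (Z s) (irrZ s) _ YZ) // => x Zx W [cW Wpt].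
by apply: (Zmin W) => // m; apply: Wpt; exists (m * p + s %% p)%N.
Qed.

Lemma affD_curveP Y : affD_curve Y ->
  (exists a b c d e : nat -> K,
    [/\ forall i, i \in end_labels n -> a i != 0 /\ b i != 0,
        alpha n a b != 0,
        Y = zariski_closure
              [set x | exists2 t : K, t != 0 &
                         forall i : 'I_n, x i = param n a b c d e i.+1 t] &
        groebner_basis (@affD_lex n) (vanishing_ideal Y)
          (affD_basis hn a b c d e)]) /\
  (exists Z : set ('I_2 -> K), plane_conic Z /\ isomorphic Y Z) /\
  smooth Y.
Proof.
move=> [a [b [c [d [e [[a2 b2 an bn] ab0 al0 ->]]]]]].
have [a0 b0] := ab0 1%N (mem_head _ _).
split; last by split; [apply: (affD_curve_conic hn)|apply: (affD_curve_smooth hn)].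
exists a, b, c, d, e; split=> //; last exact: affD_groebner_basis.
(* The parametrized set is already closed, so it is its own closure. *)
rewrite (_ : [set _ | _] = curve_image (affD_numerator a b c d e)).
  by rewrite zariski_closure_closed //; apply: (affD_curve_closed hn).
apply/seteqP; split=> x [t t0 xE]; exists t => //.
  by apply/funext => i; rewrite curve_param.
by move=> i; rewrite xE curve_param.
Qed.

End FriezeCurve.

Theorem theorem5p8 (R : realType) (n : nat) (hn : (5 <= n)%N)
    (Y : set ('I_n -> R[i])) :
  irreducible_component (@frieze_variety n (@affD n) R[i]) Y ->
  (exists a b c d e : nat -> R[i],
    [/\ forall i, i \in end_labels n -> a i != 0 /\ b i != 0,
        alpha n a b != 0,
        Y = zariski_closure
              [set x | exists2 t : R[i], t != 0 &
                         forall i : 'I_n, x i = param n a b c d e i.+1 t] &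
        groebner_basis (@affD_lex n) (vanishing_ideal Y)
          (affD_basis hn a b c d e)]) /\
  (exists Z : set ('I_2 -> R[i]), plane_conic Z /\ isomorphic Y Z) /\
  smooth Y.
Proof.
have p_gt0 : 0 < (n - 3)%:R :> R[i] by rewrite ltr0n; lia.
have [mu mu_gt1 mu_quadratic] := exists_growth_rate p_gt0.
by move=> /(frieze_variety_component hn mu_gt1 mu_quadratic)/(affD_curveP hn).
Qed.
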